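(* Let $(X_n,Y_n)_{n\geq0}$ be a random walk on the honeycomb lattice $\mathcal{H}\subset\mathbb{Z}^2$ started at $(x,y)\in\mathcal{H}$, with transition probabilities depending only on $Y_n$, such that from every level the probability of moving one level up and the probability of moving one level down are both positive. Let $a\in\mathbb{Z}$, $a\neq y$, and $\tau_a=\min\{n\geq0:Y_n=a\}$. Let $\hat X_n=X_n-\lfloor Y_n/2\rfloor$ be the first coordinate of the image of the walk under the embedding $\varphi(i,j)=(i-\lfloor j/2\rfloor,j)$ of $\mathcal{H}$ into the diagonal lattice. Then the (possibly defective) probability mass function of the rescaled first passage location, $$k\mapsto\mathbb{P}\Bigl(\tau_a<\infty,\ \tfrac12\bigl(\hat X_{\tau_a}-\hat X_0-|y-a|\bigr)=k\Bigr)=\mathbb{P}\Bigl(\tau_a<\infty,\ \tfrac12\bigl(X_{\tau_a}-x+\lfloor \tfrac y2\rfloor-\lfloor \tfrac a2\rfloor-|y-a|\bigr)=k\Bigr),\qquad k\in\mathbb{Z},$$ is a bell-shaped sequence, and it is given by the convolution of: (i) $A$ geometric sequences; (ii) $B$ reflected geometric sequences; (iii) at most $|y-a|$ reflected two-point sequences; (iv) an $\mathcal{AM}$-$\mathcal{CM}$ sequence; where $0\leq A\leq\lfloor\frac12(|y-a|-1)\rfloor$ and $0\leq B\leq\lfloor\frac12(|y-a|-1)\rfloor$.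
   Context: Honeycomb lattice (vertices of adjacent regular hexagons, represented in $\mathbb{Z}^2$): $$\mathcal{H}=\{(i,j)\in\mathbb{Z}^2:\ i \text{ even and } j\bmod 4\in\{0,3\},\ \text{ or } i\text{ odd and } j\bmod 4\in\{1,2\}\}.$$ A random walk on $\mathcal{H}$ is a time-homogeneous Markov chain that jumps only to one of the three neighbouring vertices: from $(i,j)$ with $j$ even, to $(i+1,j+1)$, $(i-1,j+1)$ or $(i,j-1)$; from $(i,j)$ with $j$ odd, to $(i+1,j-1)$, $(i-1,j-1)$ or $(i,j+1)$. The probabilities of these three jumps depend only on $j$. Sequences are real and indexed by $k\in\mathbb{Z}$. $\Delta a(k)=a(k+1)-a(k)$ and $\Delta^n=\Delta\Delta^{n-1}$. A sequence changes sign exactly $N$ times if $N$ is the largest number for which there are indices $k_0<k_1<\dots<k_N$ with $a(k_{j-1})a(k_j)<0$ for $j=1,\dots,N$. A nonnegative, not identically zero sequence $(a(k):k\in\mathbb{Z})$ is: - bell-shaped if it converges to zero at $\pm\infty$ and for every $n=1,2,\dots$ the sequence $\Delta^n a(k)$ changes sign exactly $n$ times; - $\mathcal{AM}$-$\mathcal{CM}$ (absolutely monotone then completely monotone) if $(a(k):k\geq0)$ and $(a(-k):k\geq 0)$ are both completely monotone, where $(c(k):k\geq0)$ is completely monotone if $(-1)^n\Delta^n c(k)\geq0$ for all $n,k=0,1,2,\dots$ A geometric sequence is $a(k)=p^k$ for $k\geq0$, $a(k)=0$ for $k<0$, with $p\in(0,1)$. A two-point sequence is $a(0)=p$, $a(1)=1-p$,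 $a(k)=0$ otherwise, with $p\in[0,1]$. The reflection of $a(k)$ is $a(-k)$. Convolution: $(a*b)(k)=\sum_{j\in\mathbb{Z}}a(k-j)b(j)$; a convolution of zero sequences is the sequence equal to $1$ at $0$ and $0$ elsewhere. *)

(* Defs.v *)
From HB Require Import structures.
From mathcomp Require Import all_boot all_order all_algebra.
From mathcomp Require Import all_classical all_reals all_analysis.

Set Implicit Arguments.
Unset Strict Implicit.
Unset Printing Implicit Defensive.

Import Order.TTheory GRing.Theory Num.Theory numFieldNormedType.Exports.
Local Open Scope classical_set_scope.
Local Open Scope ring_scope.

Section Sequences.
Context {R : realType}.
Implicit Types (a b : int -> R) (c : nat -> R).

Definition diffz a : int -> R := fun k => a (k + 1) - a k.

Definition diffn c : nat -> R := fun k => c k.+1 - c k.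

Definition has_sign_changes (N : nat) a : Prop :=
  exists k : nat -> int, forall j : nat, (j < N)%N ->
    k j < k j.+1 /\ a (k j) * a (k j.+1) < 0.

Definition changes_sign_exactly (N : nat) a : Prop :=
  has_sign_changes N a /\
  forall M : nat, has_sign_changes M a -> (M <= N)%N.

Definition nonneg_nonzero a : Prop :=
  (forall k, 0 <= a k) /\ (exists k, a k != 0).

Definition bell_shaped a : Prop :=
  [/\ nonneg_nonzero a,
      (fun k : nat => a k%:Z) @ \oo --> (0 : R),
      (fun k : nat => a (- k%:Z)) @ \oo --> (0 : R) &
      forall n : nat, (0 < n)%N -> changes_sign_exactly n (iter n diffz a)].

Definition completely_monotone c : Prop :=
  forall n k : nat, 0 <= (-1) ^+ n * iter n diffn c k.

Definition AM_CM a : Prop :=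
  [/\ nonneg_nonzero a,
      completely_monotone (fun k : nat => a k%:Z) &
      completely_monotone (fun k : nat => a (- k%:Z))].

Definition geometric_seq (p : R) : int -> R :=
  fun k => if 0 <= k then p ^+ `|k|%N else 0.

Definition two_point_seq (p : R) : int -> R :=
  fun k => if k == 0 then p else if k == 1 then 1 - p else 0.

Definition reflection a : int -> R := fun k => a (- k).

Definition unit_seq : int -> R := fun k => (k == 0)%:R.

(* [esum] is only meaningful for nonnegative families, hence the splitting into
   positive and negative parts; the value is the usual one whenever the series
   converges absolutely. *)
Definition convolution a b : int -> R := fun k =>
  let u := fun j : int => (a (k - j) * b j)%:E in
  fine (\esum_(j in [set: int]) (u^\+ j) - \esum_(j in [set: int]) (u^\- j))%E.

End Sequences.

Definition honeycomb : set (int * int) :=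
  [set z | (2 %| z.1)%Z && ((z.2 %% 4)%Z \in [:: 0; 3]) ||
           ~~ (2 %| z.1)%Z && ((z.2 %% 4)%Z \in [:: 1; 2])].

Inductive jump := jump_right | jump_left | jump_vertical.

Definition jump_target (e : jump) (z : int * int) : int * int :=
  let s : int := if (2 %| z.2)%Z then 1 else -1 in
  match e with
  | jump_right => (z.1 + 1, z.2 + s)
  | jump_left => (z.1 - 1, z.2 + s)
  | jump_vertical => (z.1, z.2 - s)
  end.

Section Walk.
Context {R : realType}.

(* [q j e] is the probability of the jump [e] from a vertex at level [j]. *)
Definition jump_law (q : int -> jump -> R) : Prop :=
  (forall j e, 0 <= q j e) /\
  (forall j, q j jump_right + q j jump_left + q j jump_vertical = 1).

Definition prob_up (q : int -> jump -> R) (j : int) : R :=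
  if (2 %| j)%Z then q j jump_right + q j jump_left else q j jump_vertical.

Definition prob_down (q : int -> jump -> R) (j : int) : R :=
  if (2 %| j)%Z then q j jump_vertical else q j jump_right + q j jump_left.

Context {d : measure_display} {T : measurableType d}.
Implicit Type Z : nat -> T -> int * int.

Definition history Z (w : nat -> int * int) (n : nat) : set T :=
  [set t | forall m : nat, (m <= n)%N -> Z m t = w m].

(* The last clause is the Markov property
   P(Z_{n+1} = z' | Z_0 = w_0, ..., Z_n = w_n) = q(w_n, z'),
   multiplied by the probability of the conditioning event. *)
Definition honeycomb_walk (P : probability T R) (q : int -> jump -> R)
    (z0 : int * int) Z : Prop :=
  [/\ forall n t, honeycomb (Z n t),
      forall n z, measurable [set t | Z n t = z],
      P [set t | Z 0%N t = z0] = 1%E &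
      forall (w : nat -> int * int) (n : nat) (e : jump),
        P (history Z w n `&` [set t | Z n.+1 t = jump_target e (w n)]) =
        ((q (w n).2 e)%:E * P (history Z w n))%E].

(* The event [tau_a = n], where [tau_a] is the first n such that Y_n = a. *)
Definition first_passage_at Z (a : int) (n : nat) : set T :=
  [set t | (Z n t).2 = a /\ forall m : nat, (m < n)%N -> (Z m t).2 <> a].

Definition xhat (z : int * int) : int := z.1 - (z.2 %/ 2)%Z.

Definition first_passage_pmf (P : probability T R) Z (y a : int) : int -> R :=
  fun k => fine (P [set t | exists n : nat, first_passage_at Z a n t /\
    xhat (Z n t) - xhat (Z 0%N t) - `|y - a| = 2 * k]).

End Walk.

(* Main.v *)
Require Import Defs.
From HB Require Import structures.
From mathcomp Require Import all_boot all_order all_algebra.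
From mathcomp Require Import all_classical all_reals all_analysis.
From mathcomp Require Import zify ring lra.
From mathcomp Require polyrcf.

Set Implicit Arguments.
Unset Strict Implicit.
Unset Printing Implicit Defensive.

Import Order.TTheory GRing.Theory Num.Theory numFieldNormedType.Exports.
Local Open Scope classical_set_scope.
Local Open Scope ring_scope.

(* Measure levels by their distance to [a], and let [w] mark the displacement.
   A step towards [a] has a weight [f0 + f1 / w], a step away from it a weight
   [b0 + b1 w]. If only [L] levels are kept, the first passage from the level
   with [m] levels behind it and [l = |y - a| - 1] levels in front of it has the
   generating function [(product of the l + 1 forward weights) * D_m / D_L], with
   [D] the determinants of the tridiagonal matrices [1 - J]. For positive weights
   these form Sturm sequences in both directions away from [w = 1]: [D_j] has
   [j./2] simple zeros in (0,1) and as many in (1,oo), and they interlace.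
   Write [D_m / D_L = G / D'] with [D'] the determinant of the [l] levels in
   front. Then [1 / D'] is a product of geometric sequences, the forward weights
   are reflected two-point sequences, and [G = D_m D' / D_L], the Green function
   of the starting level, is AM-CM: its partial fractions have coefficients of
   the right sign by Euler's continuant identity and interlacing.
   Arbitrary weights are reached by truncating, damping and perturbing them, and
   passing to the limit: all partial convolutions converge along an ultrafilter,
   and the limit cannot degenerate because it is summable and nonzero.
   For the bell shape: convolution with a geometric or two-point sequence creates
   no sign change, the [n]-th difference of an AM-CM sequence has at most [n] of
   them, and Rolle's argument gives at least [n]. *)

(** A polynomial in [w] acts on two-sided sequences through the shift ([act]). An identity of
    rational functions is proved by clearing denominators and then cancelling a polynomial that acts
    injectively on bounded sequences, which requires that it has no zero on the unit circle.
    Positivity of the determinants at [w = 1], a consequence of the weights of a level adding up to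
    at most 1, therefore serves twice: it keeps their roots away from the circle and splits them
    evenly around it. The convolution factors are carried as recurrences ([link]), because these
    survive finite differences and pointwise limits; actual convolutions are recovered only at the
    end, where summability makes the solution of the recurrence unique. Damping makes the sum over
    path lengths converge geometrically, uniformly in the truncation and the perturbation. A
    perturbation is always called for: the three jumps from a vertex cannot give positive weight to
    all four kinds of step. *)

(** * Sign changes *)

Section SignChanges.
Context {R : realType}.
Implicit Types (p : R) (a b f g : int -> R).

Definition vanishing a := forall e : R, 0 < e ->
  exists K : nat, forall k : int, (K <= `|k|)%N -> `|a k| < e.

(** The exponent [s] fixes the sign of the first value. For [N = 0] a nonzero value is required,
    unlike in [has_sign_changes 0]; the induction on differences starts there. *)
Definition alternating (N : nat) a := exists (k : nat -> int) (s : nat),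
  (forall j, (j < N)%N -> k j < k j.+1) /\
  (forall j, (j <= N)%N -> 0 < (-1) ^+ (s + j) * a (k j)).

Lemma sign_cases (n : nat) : (-1) ^+ n = 1 :> R \/ (-1) ^+ n = -1 :> R.
Proof. by rewrite -signr_odd; case: (odd n); [right|left]. Qed.

Ltac case_sign :=
  match goal with |- context [(-1) ^+ ?n] => case: (sign_cases n) => -> end.

Lemma alternating_sign_changes N a : alternating N a -> has_sign_changes N a.
Proof.
move=> [k [s [kS ka]]]; exists k => j jN; split; first exact: kS.
have h1 := ka _ (ltnW jN); have h2 := ka _ jN.
move: h2; rewrite addnS exprS mulN1r mulNr oppr_gt0 => h2.
move: h1 h2; case_sign; rewrite ?mul1r ?mulN1r => h1 h2.
  by rewrite pmulr_rlt0.
by rewrite nmulr_rlt0 -?oppr_gt0 // -[a (k j.+1)]opprK oppr_gt0.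
Qed.

Lemma sign_changes_alternating N a :
  has_sign_changes N.+1 a -> alternating N.+1 a.
Proof.
move=> [k hk].
exists k, (a (k 0%N) < 0)%R; split=> [j jN|j]; first by have [] := hk j jN.
elim: j => [_|j IH jN].
  have [_ h] := hk 0%N isT; rewrite addn0.
  have h0 : a (k 0%N) != 0 by apply: contraTneq h => ->; rewrite mul0r ltxx.
  have [hn|hp|h1] := ltgtP (a (k 0%N)) 0; last by rewrite h1 eqxx in h0.
    by rewrite expr1 mulN1r oppr_gt0.
  by rewrite expr0 mul1r.
have := IH (ltnW jN); have [_ h] := hk j jN.
rewrite addnS exprS mulN1r mulNr; case_sign; rewrite ?mul1r ?mulN1r => h'; move: h.
  by rewrite pmulr_rlt0 // oppr_gt0.
by rewrite nmulr_rlt0 ?opprK -?oppr_gt0 ?mulN1r ?opprK // => h.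
Qed.

Lemma alternating_reflection N a : alternating N a -> alternating N (reflection a).
Proof.
move=> [k [s [kS ka]]]; exists (fun j => - k (N - j)%N), (s + N)%N; split.
  move=> j jN; rewrite ltrN2.
  have -> : (N - j = (N - j.+1).+1)%N by lia.
  by apply: kS; lia.
move=> j jN; rewrite /reflection opprK.
have := ka (N - j)%N (leq_subr _ _).
by rewrite -signr_odd -[X in _ -> 0 < X * _]signr_odd !oddD oddB // !addbA.
Qed.

Lemma vanishing_reflection a : vanishing a -> vanishing (reflection a).
Proof. by move=> va e /va[K hK]; exists K => k hk; apply: hK; rewrite abszN. Qed.

Lemma vanishing_shift a (m : int) : vanishing a -> vanishing (fun k => a (k + m)).
Proof. by move=> va e /va[K hK]; exists (K + `|m|)%N => k hk; apply: hK; lia. Qed.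

Lemma vanishingD a b : vanishing a -> vanishing b -> vanishing (fun k => a k + b k).
Proof.
move=> va vb e e0; have e2 : 0 < e / 2 by rewrite divr_gt0.
have [K hK] := va _ e2; have [L hL] := vb _ e2.
exists (K + L)%N => k hk; apply: le_lt_trans (ler_normD _ _) _.
by rewrite [e]splitr ltrD // ?hK ?hL //; lia.
Qed.

Lemma vanishing_le a b : (forall k, `|a k| <= b k) -> vanishing b -> vanishing a.
Proof.
move=> ab vb e /vb[K hK]; exists K => k /hK; apply: le_lt_trans.
exact: le_trans (ab k) (ler_norm _).
Qed.

Lemma vanishing_diffz n a : vanishing a -> vanishing (iter n diffz a).
Proof.
move=> va; elim: n => //= n IH.
apply: vanishingD; first exact: vanishing_shift.
by move=> e /IH[K hK]; exists K => k /hK; rewrite normrN.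
Qed.

Lemma diffz_rise g (x y : int) : x < y -> g x < g y ->
  exists m, [/\ x <= m, m < y & 0 < diffz g m].
Proof.
move=> xy; have -> : y = x + `|y - x|%N by lia.
have : (0 < `|y - x|)%N by lia.
elim: `|y - x|%N => // -[|n] IH _ gxy.
  by exists x; rewrite lexx ltrDl; split => //; rewrite subr_gt0.
have [gn|gn] := ltP (g x) (g (x + n.+1)).
  have [m [h1 h2 h3]] := IH isT gn; exists m; split => //; lia.
exists (x + n.+1); split; [lia|lia|].
rewrite /diffz subr_gt0; apply: le_lt_trans gn _.
by have -> : x + n.+1 + 1 = x + n.+2 :> int by lia.
Qed.

(** Discrete Rolle: since [g] vanishes at infinity, one index far to the left and one far to the
    right carry values smaller than the outermost chosen ones. Together they give [N + 2] increments
    of alternating sign, and each increment contains a difference of its own sign. *)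
Lemma alternating_diffz N g : vanishing g -> alternating N g ->
  alternating N.+1 (diffz g).
Proof.
move=> vg [k [s [kS kg]]].
have kg_neq0 j : (j <= N)%N -> 0 < `|g (k j)|.
  by move=> /kg; rewrite normr_gt0; apply: contraTneq => ->; rewrite mulr0 ltxx.
have [K hK] := vg _ (kg_neq0 0%N isT); have [L hL] := vg _ (kg_neq0 N (leqnn _)).
pose x : int := - (K + `|k 0%N|).+1%:Z; pose y : int := (L + `|k N|).+1%:Z.
have hx : `|g x| < `|g (k 0%N)| by apply: hK; lia.
have hy : `|g y| < `|g (k N)| by apply: hL; lia.
pose k' j := if j is j'.+1 then if (j' <= N)%N then k j' else y else x.
have step j : (j <= N.+1)%N -> k' j < k' j.+1 /\
    0 < (-1) ^+ (s + j) * (g (k' j.+1) - g (k' j)).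
  case: j => [_|j jN] /=; last first.
    rewrite -ltnS jN; case: ltnP => hj.
      split; first exact: kS.
      have := kg j (ltnW hj); have := kg j.+1 hj.
      rewrite !addnS exprS mulN1r; case_sign; lra.
    have -> : j = N by lia.
    split; first by rewrite /y; lia.
    have := kg N (leqnn _); rewrite addnS exprS mulN1r.
    move: hy; rewrite !ltr_norml; case_sign;
    have [h|h] := ger0P (g (k N)); lra.
  split; first by rewrite /x; lia.
  have := kg 0%N isT; rewrite addn0.
  move: hx; rewrite !ltr_norml; case_sign;
    have [h|h] := ger0P (g (k 0%N)); lra.
have /choice[m hm] : forall j, exists m : int, (j <= N.+1)%N ->
    [/\ k' j <= m, m < k' j.+1 & 0 < (-1) ^+ (s + j) * diffz g m].
  move=> j; have [jN|] := leqP j N.+1; last by exists 0.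
  have [h1 h2] := step j jN; move: h2; case_sign => h2; last first.
    have h3 : - g (k' j) < - g (k' j.+1) by lra.
    have [m [? ? h]] := @diffz_rise (fun i => - g i) _ _ h1 h3.
    by exists m => _; split=> //; move: h; rewrite /diffz; lra.
  have h3 : g (k' j) < g (k' j.+1) by lra.
  have [m [? ? h]] := @diffz_rise g _ _ h1 h3.
  by exists m => _; split=> //; lra.
exists m, s; split=> j jN; last by have [] := hm j jN.
have [_ h1 _] := hm j (ltnW jN); have [h2 _ _] := hm j.+1 jN.
exact: lt_le_trans h1 h2.
Qed.

Variant link_kind := Geo | RGeo | TP.

(** [b] is [a] convolved with a geometric, reflected geometric or reflected two-point sequence. As a
    recurrence this makes sense without summability. *)
Definition link (t : link_kind) (p : R) a b := forall k : int,
  match t with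
  | Geo => b k = a k + p * b (k - 1)
  | RGeo => b k = a k + p * b (k + 1)
  | TP => b k = p * a k + (1 - p) * a (k + 1)
  end.

Lemma link_reflection p a b :
  link RGeo p a b -> link Geo p (reflection a) (reflection b).
Proof.
move=> h k; have := h (- k); rewrite /reflection /=.
by have -> : - (k - 1) = - k + 1 by lia.
Qed.

Lemma link_diffz t p a b n :
  link t p a b -> link t p (iter n diffz a) (iter n diffz b).
Proof.
move=> h; elim: n => //= n IH k; rewrite /diffz; case: t {h} IH => IH.
- by rewrite (IH (k + 1)) addrK subrK (IH k); ring.
- by rewrite (IH k) (IH (k + 1)); ring.
- by rewrite (IH (k + 1)) (IH k); ring.
Qed.

(** When [b] changes sign between two chosen indices, [a] must take the new sign somewhere after the
    first and up to the second: otherwise the recurrence propagates the old sign ([prop]). *)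
Lemma alternating_geo p a b N : 0 <= p <= 1 -> vanishing b -> link Geo p a b ->
  alternating N b -> alternating N a.
Proof.
move=> /andP[p0 p1] vb hab [k [s [kS kb]]].
have prop (e : R) (x : int) (n : nat) : e * b x <= 0 ->
    (forall m : int, x < m <= x + n -> e * a m <= 0) -> e * b (x + n) <= 0.
  elim: n => [|n IH] hx ha; first by rewrite addr0.
  have hn : e * b (x + n) <= 0 by apply: IH => // m hm; apply: ha; lia.
  rewrite hab.
  have -> : x + n.+1 - 1 = x + n :> int by lia.
  rewrite mulrDr mulrCA; have h : e * a (x + n.+1) <= 0 by apply: ha; lia.
  have h2 : p * (e * b (x + n)) <= 0 by rewrite mulr_ge0_le0.
  by lra.
(* For the first index there is no earlier sign to propagate. If [a] never has the sign of [e] up to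
   [x] but [b x] has it, then [e * b] does not decrease towards the left, against [vanishing]. *)
have prop0 (e : R) (x : int) : `|e| = 1 -> (forall m : int, m <= x -> e * a m <= 0) ->
    e * b x <= 0.
  move=> e1 ha; rewrite leNgt; apply/negP => ebx.
  have [K hK] := vb _ ebx.
  have hlow (n : nat) : e * b x <= e * b (x - n%:Z).
    elim: n => [|n IH]; first by rewrite subr0.
    apply: (le_trans IH); rewrite hab.
    have -> : x - n%:Z - 1 = x - n.+1%:Z :> int by lia.
    have h : e * a (x - n%:Z) <= 0 by apply: ha; lia.
    rewrite mulrDr.
    have [b0|b0] := leP 0 (e * b (x - n.+1%:Z)); first by rewrite mulrCA; nra.
    exfalso; move: IH; rewrite [b (x - _)]hab mulrDr.
    have -> : x - n%:Z - 1 = x - n.+1%:Z :> int by lia.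
    by rewrite mulrCA => IH; nra.
  have := hlow (K + `|x|)%N; apply/negP; rewrite -ltNge.
  apply: le_lt_trans (ler_norm _) _; rewrite normrM e1 mul1r.
  by apply: hK; lia.
have sg (j : nat) : `|(-1) ^+ j : R| = 1 by rewrite normrX normrN1 expr1n.
have /choice[m hm] : forall j, exists m : int, (j <= N)%N ->
    [/\ (0 < j)%N -> k j.-1 < m, m <= k j & 0 < (-1) ^+ (s + j) * a m].
  case=> [|j].
    apply: contrapT => /forallNP no.
    have := kb 0%N isT; rewrite ltNge => /negP; apply.
    apply: prop0 => // m hm; rewrite leNgt; apply/negP => am.
    by apply: (no m).
  have [jN|] := leqP j.+1 N; last by exists 0.
  apply: contrapT => /forallNP no.
  have := kb _ jN; rewrite ltNge => /negP; apply.
  have kj := kS j jN.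
  have -> : k j.+1 = k j + `|k j.+1 - k j|%N by lia.
  apply: prop.
    by have := kb j (ltnW jN); rewrite addnS exprS mulN1r mulNr; lra.
  move=> m hm; rewrite leNgt; apply/negP => am.
  by apply: (no m); split => //=; lia.
exists m, s; split=> j jN; last by have [] := hm j jN.
have [_ h1 _] := hm j (ltnW jN); have [h2 _ _] := hm j.+1 jN.
exact: le_lt_trans h1 (h2 isT).
Qed.

(** A convex combination of [a k] and [a (k + 1)] has a given sign only if one of the two has it.
    Consecutive choices cannot coincide, as their signs are opposite. *)
Lemma alternating_two_point p a b N : 0 <= p <= 1 -> link TP p a b ->
  alternating N b -> alternating N a.
Proof.
move=> /andP[p0 p1] hab [k [s [kS kb]]].
have /choice[m hm] : forall j, exists m : int, (j <= N)%N ->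
    [/\ k j <= m, m <= k j + 1 & 0 < (-1) ^+ (s + j) * a m].
  move=> j; have [jN|] := leqP j N; last by exists 0.
  have := kb j jN; rewrite hab mulrDr => h.
  have [h1|h1] := ltP 0 ((-1) ^+ (s + j) * a (k j)).
    by exists (k j) => _; split => //; lia.
  exists (k j + 1) => _; split; [lia|lia|].
  rewrite ltNge; apply/negP => h2.
  move: h; rewrite mulrCA (mulrCA _ (1 - p)).
  move: h1 h2; set u := _ * a (k j); set v := _ * a _ => h1 h2 h.
  have : 0 <= p * (- u) by rewrite mulr_ge0 ?oppr_ge0.
  have : 0 <= (1 - p) * (- v) by rewrite mulr_ge0 ?oppr_ge0 ?subr_ge0.
  by rewrite !mulrN; lra.
exists m, s; split=> j jN; last by have [] := hm j jN.
have [_ h1 ha1] := hm j (ltnW jN); have [h2 _ ha2] := hm j.+1 jN.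
have := kS j jN => kj.
have : m j <= m j.+1 by lia.
rewrite le_eqVlt => /orP[/eqP mj|//].
move: ha1 ha2; rewrite mj addnS exprS mulN1r mulNr => ? ?; exfalso; lra.
Qed.

Lemma alternating_link t p a b N : 0 <= p <= 1 -> vanishing b -> link t p a b ->
  alternating N b -> alternating N a.
Proof.
case: t => hp vb hl hN.
- exact: alternating_geo hp vb hl hN.
- have -> : a = reflection (reflection a).
    by apply/funext => k; rewrite /reflection opprK.
  apply: alternating_reflection.
  apply: alternating_geo hp _ (link_reflection hl) (alternating_reflection hN).
  exact: vanishing_reflection.
- exact: alternating_two_point hp hl hN.
Qed.

Lemma iter_diffz_nneg n a (k : nat) :
  iter n diffz a k = iter n diffn (fun i : nat => a i) k.
Proof.
elim: n k => //= n IH k; rewrite /diffz /diffn -!IH.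
by have -> : k%:Z + 1 = k.+1%:Z by lia.
Qed.

Lemma iter_diffz_npos n a (k : nat) : iter n diffz a (- (k + n)%:Z) =
  (-1) ^+ n * iter n diffn (fun i : nat => a (- i%:Z)) k.
Proof.
elim: n k => [|n IH] k; first by rewrite addn0 expr0 mul1r.
rewrite iterS /diffz.
have -> : - (k + n.+1)%:Z + 1 = - (k + n)%:Z by lia.
have -> : (k + n.+1 = k.+1 + n)%N by lia.
rewrite !IH iterS /diffn exprS; ring.
Qed.

(** The [n]-th difference has a constant sign on the indices [>= 0] and on those [<= - n]. Hence at
    most one chosen index lies in each of these ranges, and the others are among the [n - 1]
    integers strictly between [- n] and 0. *)
Lemma AM_CM_alternating n M a : AM_CM a -> (0 < n)%N ->
  alternating M (iter n diffz a) -> (M <= n)%N.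
Proof.
move=> [_ cm am] n0 [k [s [kS ka]]].
case: M kS ka => // -[|M] kS ka; first by [].
have pos (i : int) : 0 <= i -> 0 <= (-1) ^+ n * iter n diffz a i.
  by case: i => // i _; rewrite iter_diffz_nneg; apply: cm.
have neg (i : int) : i <= - n%:Z -> 0 <= iter n diffz a i.
  move=> i0; have [l ->] : exists l : nat, i = - (l + n)%:Z.
    by exists (`|i| - n)%N; lia.
  by rewrite iter_diffz_npos; apply: am.
have kmono i l : (i + l <= M.+2)%N -> l%:Z <= k (i + l)%N - k i.
  elim: l => [|l IH] h; first by rewrite addn0 subrr.
  have := IH ltac:(lia); have := kS (i + l)%N ltac:(lia); rewrite -addnS; lia.
have h1 : - n%:Z < k 1%N.
  rewrite ltNge; apply/negP => h.
  have := neg _ h; have := kS 0%N isT => k01.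
  have := neg (k 0%N) ltac:(lia).
  have := ka 0%N isT; have := ka 1%N isT.
  rewrite addn0 addn1 exprS; case_sign; lra.
have h2 : k M.+1 < 0.
  rewrite ltNge; apply/negP => h.
  have := pos _ h; have := kS M.+1 (leqnn _) => k01.
  have := pos (k M.+2) ltac:(lia).
  have := ka M.+1 (leqnSn _); have := ka M.+2 (leqnn _).
  rewrite addnS exprS mulN1r; case_sign; case_sign; lra.
have := kmono 1%N M ltac:(lia); rewrite add1n; lia.
Qed.

(** The kinds of the factors, outermost first, are fixed by [ts], and their parameters are
    existential: a limit keeps the list and moves the parameters. For the same reason a geometric
    factor may have [p = 0]. *)
Fixpoint decomposable (ts : seq link_kind) f : Prop :=
  if ts is t :: ts' then exists (p : R) b,
    [/\ 0 <= p <= 1, t <> TP -> p < 1, forall k, 0 <= b k, link t p b f &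
        decomposable ts' b]
  else AM_CM f.

(** The input of a factor is controlled by its output, so that boundedness, vanishing and
    summability are inherited by all inner sequences. *)
Lemma link_le t p a b k : 0 <= p <= 1 -> (forall k, 0 <= a k) ->
  (forall k, 0 <= b k) -> link t p a b -> a k <= b k + b (k - 1).
Proof.
move=> /andP[p0 p1] a0 b0 h.
case: t h => h.
- by have := h k; have := b0 k; have := b0 (k - 1); nra.
- by have := h k; have := b0 k; have := b0 (k - 1); have := b0 (k + 1); nra.
- have := h (k - 1); rewrite subrK; have := h k.
  have := a0 k; have := a0 (k - 1); have := a0 (k + 1); nra.
Qed.

Lemma vanishing_link t p a b : 0 <= p <= 1 -> (forall k, 0 <= a k) ->
  (forall k, 0 <= b k) -> link t p a b -> vanishing b -> vanishing a.
Proof.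
move=> hp a0 b0 h vb; apply: (@vanishing_le _ (fun k => b k + b (k - 1))).
  by move=> k; rewrite ger0_norm //; apply: link_le h.
by apply: vanishingD => //; apply: vanishing_shift.
Qed.

Lemma decomposable_alternating ts n M f : (forall k, 0 <= f k) -> vanishing f ->
  decomposable ts f -> (0 < n)%N -> alternating M (iter n diffz f) -> (M <= n)%N.
Proof.
elim: ts f => [|t ts IH] f f0 vf /=; first by move=> hf n0; apply: AM_CM_alternating hf n0.
move=> [p [b [hp _ b0 hl hb]]] n0 hM; apply: (IH b) => //.
  exact: vanishing_link hl vf.
apply: alternating_link hp _ (link_diffz n hl) hM.
exact: vanishing_diffz.
Qed.

Lemma vanishing_cvg f : vanishing f ->
  (fun k : nat => f k%:Z) @ \oo --> (0 : R) /\
  (fun k : nat => f (- k%:Z)) @ \oo --> (0 : R).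
Proof.
move=> vf; split; apply/cvgrPdist_lt => e /vf[K hK]; exists K => // k /= Kk;
  by rewrite sub0r normrN; apply: hK; lia.
Qed.

Lemma decomposable_bell_shaped ts f : nonneg_nonzero f -> vanishing f ->
  decomposable ts f -> bell_shaped f.
Proof.
move=> [f0 [k0 fk0]] vf df; have [c1 c2] := vanishing_cvg vf.
split => // [|n n0]; first by split=> //; exists k0.
have alt m : alternating m (iter m diffz f).
  elim: m => [|m IH] /=.
    exists (fun=> k0), 0%N; split=> // j; rewrite leqn0 => /eqP ->.
    by rewrite expr0 mul1r lt_def fk0 f0.
  by apply: alternating_diffz => //; apply: vanishing_diffz.
split; first exact: alternating_sign_changes.
case=> // M /sign_changes_alternating; exact: decomposable_alternating vf df n0.
Qed.

End SignChanges.

(** * Limits of decomposable sequences *)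

Section Closure.
Context {R : realType} (U : set_system nat) {UU : UltraFilter U}.
Implicit Types (p : R) (a b f g : int -> R) (u v : nat -> R).

(** This replaces a diagonal extraction: along one ultrafilter the parameters and all values of all
    partial convolutions converge at once. *)
Lemma bounded_ultra_cvg u (C : R) : (forall m, 0 <= u m <= C) ->
  exists l, u @ U --> (l : R).
Proof.
move=> hu; have := @segment_compact R 0 C.
move=> /(_ (u @ U) (fmap_proper_filter _ _))[|l [_ ul]].
  by apply: (@filterE _ U) => m; rewrite /= in_itv /=; exact: hu.
exists l => V lV.
have [//|UV] := in_ultra_setVsetC (u @^-1` V) UU.
by have [x []] := ul (~` V) V UV lV.
Qed.

Lemma cvg_ge0 u (l : R) : (forall m, 0 <= u m) -> u @ U --> l -> 0 <= l.
Proof.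
move=> u0 ul; rewrite -(cvg_lim _ ul) //; apply: limr_ge; first exact: cvgP ul.
exact: nearW.
Qed.

Lemma cvg_le u v (l k : R) : (forall m, u m <= v m) ->
  u @ U --> l -> v @ U --> k -> l <= k.
Proof.
move=> uv ul vk; rewrite -subr_ge0; apply: (@cvg_ge0 (v \- u)).
  by move=> m; rewrite subr_ge0.
exact: cvgB.
Qed.

Lemma link_cvg t (p : nat -> R) (a b : nat -> int -> R) pl al bl :
  (forall m, link t (p m) (a m) (b m)) -> p @ U --> pl ->
  (forall k, a^~ k @ U --> al k) -> (forall k, b^~ k @ U --> bl k) ->
  link t pl al bl.
Proof.
move=> h hp ha hb k.
suff : b^~ k @ U --> match t with
  | Geo => al k + pl * bl (k - 1)
  | RGeo => al k + pl * bl (k + 1)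
  | TP => pl * al k + (1 - pl) * al (k + 1) end.
  move/cvg_lim => /(_ (@Rhausdorff R)); rewrite (cvg_lim _ (hb k)) // => ->.
  by case: (t).
case: t h => h.
  + have -> : b^~ k = (fun m => a m k + p m * b m (k - 1)).
      by apply/funext => m; exact: h.
    by apply: cvgD => //; apply: cvgM.
  + have -> : b^~ k = (fun m => a m k + p m * b m (k + 1)).
      by apply/funext => m; exact: h.
    by apply: cvgD => //; apply: cvgM.
  + have -> : b^~ k = (fun m => p m * a m k + (1 - p m) * a m (k + 1)).
      by apply/funext => m; exact: h.
    by apply: cvgD => //; apply: cvgM => //; apply: cvgB => //; apply: cvg_cst.
Qed.

Lemma vanishing_nondecreasing_eq0 b : (forall k, 0 <= b k) -> vanishing b ->
  (forall k, b (k - 1) <= b k) -> forall k, b k = 0.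
Proof.
move=> b0 vb hb k; apply/eqP; rewrite eq_le b0 andbT leNgt; apply/negP => bk.
have [K hK] := vb _ bk.
have hn (n : nat) : b k <= b (k + n).
  elim: n => [|n IH]; first by rewrite addr0.
  apply: (le_trans IH); have := hb (k + n.+1).
  by have -> : k + n.+1 - 1 = k + n :> int by lia.
have := hK (k + (K + `|k|)%N) ltac:(lia).
by rewrite ger0_norm // ltNge hn.
Qed.

(* In a limit of geometric factors the parameter may tend to 1: [b] is then
   nondecreasing and vanishes at infinity, so that the limit is 0. *)
Lemma link_Geo_degenerate p a b : 0 <= p <= 1 -> (forall k, 0 <= a k) ->
  (forall k, 0 <= b k) -> vanishing b -> link Geo p a b ->
  p = 1 \/ (forall k, a k = 0) -> forall k, b k = 0.
Proof.
move=> /andP[p0 p1] a0 b0 vb h [p1'|az].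
  by apply: vanishing_nondecreasing_eq0 => // k; rewrite [leRHS]h p1' mul1r lerDr.
have hd k : reflection b k = 0.
  apply: vanishing_nondecreasing_eq0; first by move=> i; apply: b0.
    exact: vanishing_reflection.
  move=> i; rewrite /reflection.
  have := h (- i + 1); rewrite az add0r addrK => e.
  have -> : - (i - 1) = - i + 1 by lia.
  by rewrite e ler_piMl.
by move=> k; have := hd (- k); rewrite /reflection opprK.
Qed.

Lemma link_degenerate t p a b : 0 <= p <= 1 -> (forall k, 0 <= a k) ->
  (forall k, 0 <= b k) -> vanishing b -> link t p a b -> t <> TP ->
  p = 1 \/ (forall k, a k = 0) -> forall k, b k = 0.
Proof.
case: t => // hp a0 b0 vb h _ hd; first exact: link_Geo_degenerate h hd.
have := @link_Geo_degenerate p (reflection a) (reflection b) hp.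
move=> /(_ (fun k => a0 _) (fun k => b0 _) (vanishing_reflection vb)).
move=> /(_ (link_reflection h)) hz k.
rewrite -[k]opprK; apply: hz; case: hd => [->|az]; [by left|right => i; exact: az].
Qed.

Lemma completely_monotone_cvg (c : nat -> nat -> R) cl :
  (forall m, completely_monotone (c m)) -> (forall k, c^~ k @ U --> cl k) ->
  completely_monotone cl.
Proof.
move=> hc hl n k.
apply: (@cvg_ge0 (fun m => (-1) ^+ n * iter n diffn (c m) k)).
  by move=> m; apply: hc.
apply: cvgMr.
elim: n k => [|n IH] k /=; first exact: hl.
by apply: cvgB.
Qed.

(** Two things could go wrong in the limit: a geometric parameter tends to 1, or an inner sequence
    tends to 0. Either would force [f = 0], since [f] vanishes at infinity. *)
Lemma decomposable_cvg ts (C : R) (fm : nat -> int -> R) f :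
  (forall m k, 0 <= fm m k <= C) -> (forall m, decomposable ts (fm m)) ->
  (forall k, fm^~ k @ U --> f k) -> vanishing f -> (exists k, f k != 0) ->
  decomposable ts f.
Proof.
elim: ts C fm f => [|t ts IH] C fm f bf df cf vf [k0 fk0] /=.
  split; [split; last by exists k0| |].
  - by move=> k; apply: cvg_ge0 (cf k) => m; have /andP[] := bf m k.
  - by apply: (@completely_monotone_cvg (fun m k => fm m k)) => // m; have [] := df m.
  - apply: (@completely_monotone_cvg (fun m k => fm m (- k%:Z))) => // m.
    by have [] := df m.
have f0 k : 0 <= f k.
  by apply: cvg_ge0 (cf k) => m; have /andP[] := bf m k.
have /choice[p /choice[b hb]] : forall m, exists p : R, exists b,
  [/\ 0 <= p <= 1, t <> TP -> p < 1, forall k, 0 <= b k, link t p b (fm m) &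
        decomposable ts b] by exact: df.
have [pl ppl] : exists l, p @ U --> (l : R).
  by apply: (@bounded_ultra_cvg _ 1) => m; have [] := hb m.
(* The uniform bound doubles with every factor, by [link_le]. *)
have bb m k : 0 <= b m k <= C + C.
  have [hp _ b0 hl _] := hb m; rewrite b0 /=.
  have fm0 i : 0 <= fm m i by have /andP[] := bf m i.
  apply: (le_trans (link_le k hp b0 fm0 hl)).
  by rewrite lerD //; have /andP[] := bf m k; have /andP[] := bf m (k - 1).
have /choice[bl hbl] : forall k, exists l, b^~ k @ U --> (l : R).
  by move=> k; apply: (@bounded_ultra_cvg _ (C + C)) => m; apply: bb.
have b0 k : 0 <= bl k.
  by apply: cvg_ge0 (hbl k) => m; have /andP[] := bb m k.
have hp : 0 <= pl <= 1.
  apply/andP; split; first by apply: cvg_ge0 ppl => m; have [/andP[]] := hb m.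
  apply: (@cvg_le p (cst 1)) ppl _; last exact: cvg_cst.
  by move=> m; have [/andP[]] := hb m.
have hl : link t pl bl f.
  by apply: link_cvg ppl hbl cf => m; have [] := hb m.
exists pl, bl; split=> // [tTP|].
  have [_ p1] := andP hp; rewrite lt_neqAle p1 andbT.
  apply: contra_neq fk0 => p1'.
  by apply: (link_degenerate hp b0 f0 vf hl tTP); left.
apply: (IH (C + C) b) => //.
- by move=> m; have [] := hb m.
- exact: vanishing_link hl vf.
- apply: contrapT => /forallNP bz.
  have bz' k : bl k = 0 by apply/eqP/negPn/negP; exact: bz.
  move/eqP: fk0; apply; have [tTP|tTP] := pselect (t = TP).
    by move: (hl k0); rewrite tTP !bz' !mulr0 addr0.
  by apply: (link_degenerate hp b0 f0 vf hl tTP); right.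
Qed.

End Closure.

(** * Convolution *)

Section Convolution.
Context {R : realType}.
Implicit Types (p : R) (a b c f : int -> R).

Definition esumz a : \bar R := \esum_(j in [set: int]) (a j)%:E.

Definition nonneg_summable a := (forall k, 0 <= a k) /\ (esumz a < +oo)%E.

(** One inequality suffices: the other one is the first applied to [r^-1]. *)
Lemma esumZl (r : R) (T : choiceType) (a : T -> \bar R) : 0 <= r ->
  (forall j, 0 <= a j)%E ->
  (\esum_(j in [set: T]) (r%:E * a j) = r%:E * \esum_(j in [set: T]) a j)%E.
Proof.
have le (s : R) (g : T -> \bar R) : 0 <= s -> (forall j, 0 <= g j)%E ->
    (\esum_(j in [set: T]) (s%:E * g j) <= s%:E * \esum_(j in [set: T]) g j)%E.
  move=> s0 g0; apply: ge_ereal_sup => _ [X [finX XI] <-].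
  rewrite -ge0_mule_fsumr //.
  apply: lee_pmul => //; first exact: fsume_ge0.
  by apply: esum_ge; exists X.
rewrite le_eqVlt => /orP[/eqP <-|r0] a0.
  by rewrite mul0e esum1 // => j _; rewrite mul0e.
apply/eqP; rewrite eq_le; apply/andP; split; first by apply: le; rewrite ?ltW.
have s0 : 0 <= r^-1 by rewrite invr_ge0 ltW.
have rs : r * r^-1 = 1 by rewrite divff ?gt_eqF.
have -> : \esum_(j in [set: T]) a j =
    (\esum_(j in [set: T]) ((r^-1)%R%:E * (r%:E * a j)))%E.
  by apply: eq_esum => j _; rewrite muleA -EFinM mulrC rs mul1e.
have ra0 j : (0 <= r%:E * a j)%E by rewrite mule_ge0 // lee_fin ltW.
have h := le _ _ s0 ra0.
apply: (le_trans (lee_wpmul2l _ h)); first by rewrite lee_fin ltW.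
by rewrite muleA -EFinM rs mul1e.
Qed.

Lemma esum_int_shift (k : int) (u : int -> \bar R) :
  \esum_(j in [set: int]) u j = \esum_(j in [set: int]) u (j + k).
Proof.
apply: reindex_esum; split; [by []|by move=> x y _ _ /addIr|].
by move=> y _; exists (y - k) => //; rewrite subrK.
Qed.

Lemma esum_int_opp (u : int -> \bar R) :
  \esum_(j in [set: int]) u j = \esum_(j in [set: int]) u (- j).
Proof.
apply: reindex_esum; split; [by []|by move=> x y _ _ /oppr_inj|].
by move=> y _; exists (- y) => //; rewrite opprK.
Qed.

Lemma esum_exchange (u : int -> int -> \bar R) : (forall i j, 0 <= u i j)%E ->
  \esum_(i in [set: int]) \esum_(j in [set: int]) u i j =
  \esum_(j in [set: int]) \esum_(i in [set: int]) u i j.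
Proof.
move=> u0; rewrite !(@esum_esum _ _ _ setT (fun=> setT)) //.
apply: (@reindex_esum _ _ _ _ _ (fun x : int * int => (x.2, x.1)) (fun k => u k.1 k.2)).
split; [by []|by move=> [? ?] [? ?] _ _ [-> ->]|].
by move=> [i j] _; exists (j, i).
Qed.

Lemma esum_dirac (i : int) (x : R) : 0 <= x ->
  \esum_(j in [set: int]) ((j == i)%:R * x)%:E = x%:E.
Proof.
move=> x0; rewrite -(@esum_set1 _ _ i (fun=> x%:E)) // [RHS]esum_mkcond.
apply: eq_esum => j _; case: eqP => [->|/eqP ji].
  by rewrite mem_set // mul1r.
by rewrite memNset ?mul0r //= => /eqP; rewrite (negbTE ji).
Qed.

Lemma nonneg_summable_le a b : (forall k, 0 <= a k <= b k) ->
  nonneg_summable b -> nonneg_summable a.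
Proof.
move=> h [_ bs]; split=> [k|]; first by have /andP[] := h k.
apply: le_lt_trans bs; apply: le_esum => j _.
by rewrite lee_fin; have /andP[] := h j.
Qed.

Lemma nonneg_summableD a b : nonneg_summable a -> nonneg_summable b ->
  nonneg_summable (fun k => a k + b k).
Proof.
move=> [a0 sa] [b0 sb]; split=> [k|]; first by rewrite addr_ge0.
rewrite /esumz; under eq_esum do rewrite EFinD.
by rewrite esumD ?lte_add_pinfty // => j _; rewrite lee_fin.
Qed.

Lemma nonneg_summable_shift (m : int) a : nonneg_summable a ->
  nonneg_summable (fun k => a (k + m)).
Proof.
move=> [a0 sa]; split=> [k|]; first exact: a0.
by rewrite /esumz -(esum_int_shift m (fun j => (a j)%:E)).
Qed.

Lemma nonneg_summable_reflection a : nonneg_summable a ->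
  nonneg_summable (reflection a).
Proof.
move=> [a0 sa]; split=> [k|]; first exact: a0.
by rewrite /esumz -(esum_int_opp (fun j => (a j)%:E)).
Qed.

Lemma nonneg_summable_bounded a : nonneg_summable a ->
  exists C : R, forall k, a k <= C.
Proof.
move=> [a0 sa]; exists (fine (esumz a)) => k.
rewrite -lee_fin fineK; last first.
  by rewrite ge0_fin_numE //; apply: esum_ge0 => j _; rewrite lee_fin.
rewrite -(esum_dirac k (a0 k)); apply: le_esum => j _.
by case: eqP => [->|_]; rewrite ?mul1r // mul0r lee_fin.
Qed.

Lemma convolutionE a b k : (forall i, 0 <= a i) -> (forall i, 0 <= b i) ->
  convolution a b k = fine (\esum_(j in [set: int]) (a (k - j) * b j)%:E).
Proof.
move=> a0 b0; rewrite /convolution.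
set u := fun j : int => _.
have u0 j : (0 <= u j)%E by rewrite lee_fin mulr_ge0.
rewrite (_ : esum _ u^\-%E = 0%E) ?sube0; last first.
  by apply: esum1 => j _; rewrite funenegE max_r // oppe_le0.
by congr fine; apply: eq_esum => j _; rewrite funeposE max_l.
Qed.

Lemma convolution_esum a b k : nonneg_summable a -> nonneg_summable b ->
  (convolution a b k)%:E = \esum_(j in [set: int]) (a (k - j) * b j)%:E.
Proof.
move=> sa [b0 sb]; have [a0 _] := sa; have [C hC] := nonneg_summable_bounded sa.
have C0 : 0 <= C by apply: le_trans (hC 0).
rewrite convolutionE // fineK // ge0_fin_numE; last first.
  by apply: esum_ge0 => j _; rewrite lee_fin mulr_ge0.
apply: (@le_lt_trans _ _ (C%:E * esumz b)%E); last by rewrite lte_mul_pinfty.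
rewrite -esumZl //.
by apply: le_esum => j _; rewrite -EFinM lee_fin ler_wpM2r.
Qed.

Lemma convolution_ge0 a b k : (forall i, 0 <= a i) -> (forall i, 0 <= b i) ->
  0 <= convolution a b k.
Proof.
move=> a0 b0; rewrite convolutionE //; apply: fine_ge0; apply: esum_ge0 => j _.
by rewrite lee_fin mulr_ge0.
Qed.

Lemma nonneg_summable_convolution a b : nonneg_summable a -> nonneg_summable b ->
  nonneg_summable (convolution a b).
Proof.
move=> sa sb; have [a0 sa'] := sa; have [b0 sb'] := sb.
split=> [k|]; first exact: convolution_ge0.
rewrite /esumz; under eq_esum do rewrite convolution_esum //.
rewrite esum_exchange; last by move=> *; rewrite lee_fin mulr_ge0.
rewrite (@eq_esum _ _ _ _ (fun j => ((b j)%:E * esumz a)%E)); last first.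
  move=> j _; rewrite (esum_int_shift j) -esumZl //.
  by apply: eq_esum => i _; rewrite addrK -EFinM mulrC.
rewrite -(fineK (_ : esumz a \is a fin_num)); last first.
  by rewrite ge0_fin_numE //; apply: esum_ge0 => j _; rewrite lee_fin.
under eq_esum do rewrite muleC.
rewrite esumZl ?lte_mul_pinfty ?lee_fin //; apply: fine_ge0.
- by apply: esum_ge0 => j _; rewrite lee_fin.
- by apply: esum_ge0 => j _; rewrite lee_fin.
Qed.

Lemma convolutionA a b c : nonneg_summable a -> nonneg_summable b ->
  nonneg_summable c ->
  convolution (convolution a b) c = convolution a (convolution b c).
Proof.
move=> sa sb sc; have [a0 _] := sa; have [b0 _] := sb; have [c0 _] := sc.
apply/funext => k; apply: EFin_inj.
rewrite !convolution_esum //; try exact: nonneg_summable_convolution.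
transitivity (\esum_(j in [set: int]) \esum_(i in [set: int])
    (a (k - i) * (b (i - j) * c j))%:E).
  apply: eq_esum => j _; rewrite EFinM convolution_esum // muleC -esumZl //.
    rewrite [RHS](esum_int_shift j); apply: eq_esum => i _.
    by rewrite -EFinM mulrC -mulrA addrK opprD addrA addrAC.
  by move=> *; rewrite lee_fin mulr_ge0.
rewrite esum_exchange; last by move=> *; rewrite lee_fin !mulr_ge0.
apply: eq_esum => j _; rewrite EFinM convolution_esum // -esumZl //.
by move=> *; rewrite lee_fin mulr_ge0.
Qed.

Lemma convolution_unit b : (forall k, 0 <= b k) -> convolution unit_seq b = b.
Proof.
move=> b0; apply/funext => k; rewrite convolutionE //.
transitivity (fine (\esum_(j in [set: int]) ((j == k)%:R * b k)%:E)).
  congr fine; apply: eq_esum => j _; rewrite /unit_seq subr_eq0 eq_sym.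
  by case: eqP => [->|_] //; rewrite !mul0r.
by rewrite esum_dirac.
Qed.

Lemma convolution_reflection a b : (forall k, 0 <= a k) -> (forall k, 0 <= b k) ->
  convolution (reflection a) (reflection b) = reflection (convolution a b).
Proof.
move=> a0 b0; apply/funext => k; rewrite [RHS]/reflection !convolutionE //;
  do ?[by move=> i; apply: a0|by move=> i; apply: b0].
rewrite [in LHS]esum_int_opp; congr fine; apply: eq_esum => j _.
by rewrite /reflection !opprK opprD.
Qed.

Lemma sum_geometric_le p n : 0 <= p < 1 -> \sum_(i < n) p ^+ i <= (1 - p)^-1.
Proof.
move=> /andP[p0 p1]; rewrite -[leRHS]mul1r ler_pdivlMr ?subr_gt0 //.
have := subrX1 p n; have := exprn_ge0 n p0.
set S := \sum_(_ < _) _ => h e; have -> : S * (1 - p) = - ((p - 1) * S) by ring.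
by rewrite -e; lra.
Qed.

Lemma nonneg_summable_geometric p : 0 <= p < 1 -> nonneg_summable (geometric_seq p).
Proof.
move=> /andP[p0 p1]; split=> [k|].
  by rewrite /geometric_seq; case: ifP => // _; rewrite exprn_ge0.
rewrite /esumz (@eq_esum _ _ _ _
  (fun j : int => if j \in range Posz then (geometric_seq p j)%:E else 0%E)).
  rewrite -esum_mkcond esum_image; last by move=> x y _ _ [].
  rewrite (@eq_esum _ _ _ _ (fun n => (p ^+ n)%:E)); last by [].
  rewrite -nneseries_esumT; last by move=> n; rewrite lee_fin exprn_ge0.
  apply: (@le_lt_trans _ _ ((1 - p)^-1)%:E); last exact: ltry.
  apply: lime_le.
    by apply: is_cvg_nneseries => n _ _; rewrite lee_fin exprn_ge0.
  apply: nearW => n; rewrite sumEFin lee_fin big_mkord.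
  by apply: sum_geometric_le; rewrite p0 p1.
move=> j _; case: ifPn => // /negP hj; rewrite /geometric_seq.
by case: j hj => // n []; apply: mem_set; exists n.
Qed.

Definition kernel (t : link_kind) p : int -> R :=
  match t with
  | Geo => geometric_seq p
  | RGeo => reflection (geometric_seq p)
  | TP => reflection (two_point_seq p)
  end.

Lemma nonneg_summable_kernel t p : 0 <= p <= 1 -> (t <> TP -> p < 1) ->
  nonneg_summable (kernel t p).
Proof.
move=> /andP[p0 p1] p1'; case: t p1' => /= p1'.
- by apply: nonneg_summable_geometric; rewrite p0 p1'.
- by apply/nonneg_summable_reflection/nonneg_summable_geometric; rewrite p0 p1'.
- apply: nonneg_summable_reflection.
  pose u i x (j : int) : R := (j == i)%:R * x.
  have su i x : 0 <= x -> nonneg_summable (u i x).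
    by move=> x0; split=> [k|]; rewrite ?mulr_ge0 // /esumz esum_dirac // ltry.
  have := nonneg_summableD (su 0 p p0) (su 1 (1 - p) ltac:(by rewrite subr_ge0)).
  congr nonneg_summable; apply/funext => k; rewrite /u /two_point_seq.
  case: eqP => [->|_]; first by rewrite mul1r mul0r addr0.
  by case: eqP => _; rewrite !mul0r ?mul1r add0r.
Qed.

Lemma geometric_link p b : 0 <= p < 1 -> nonneg_summable b ->
  link Geo p b (convolution (geometric_seq p) b).
Proof.
move=> hp sb k; have [b0 _] := sb; have sg := nonneg_summable_geometric hp.
have [g0 _] := sg; have /andP[p0 _] := hp.
apply: EFin_inj; rewrite EFinD EFinM !convolution_esum // -esumZl //; last first.
  by move=> j; rewrite lee_fin mulr_ge0.
rewrite -(esum_dirac k (b0 k)) -esumD; last 2 first.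
- by move=> j _; rewrite lee_fin mulr_ge0.
- by move=> j _; rewrite -EFinM lee_fin !mulr_ge0.
apply: eq_esum => j _; rewrite -EFinM -EFinD /geometric_seq; congr EFin.
have [->|jk] := eqVneq j k.
  rewrite subrr lexx mul1r; have -> : 0 <= k - 1 - k = false by lia.
  by rewrite mul0r mulr0 addr0.
rewrite mul0r add0r mulrA; congr (_ * _).
have [h|h] := leP 0 (k - 1 - j).
  have -> : 0 <= k - j by lia.
  have -> : absz (k - j)%R = (absz (k - 1 - j)%R).+1 by lia.
  by rewrite exprS.
have -> : 0 <= k - j = false by lia.
by rewrite mulr0.
Qed.

(** The difference of two solutions satisfies the homogeneous recurrence, so it equals [p ^+ n]
    times a bounded quantity for every [n]. *)
Lemma geometric_unique p b f : 0 <= p < 1 -> nonneg_summable b -> nonneg_summable f ->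
  link Geo p b f -> f = convolution (geometric_seq p) b.
Proof.
move=> hp sb sf hf; apply/funext => k.
have hg := geometric_link hp sb.
have sg := nonneg_summable_convolution (nonneg_summable_geometric hp) sb.
move: hg sg; set g := convolution _ _ => hg sg.
have [C hC] := nonneg_summable_bounded sf; have [D hD] := nonneg_summable_bounded sg.
have [f0 _] := sf; have [g0 _] := sg; have /andP[p0 p1] := hp.
have hn (n : nat) : f k - g k = p ^+ n * (f (k - n%:Z) - g (k - n%:Z)).
  elim: n => [|n ->]; first by rewrite expr0 mul1r subr0.
  rewrite (hf (k - n%:Z)) (hg (k - n%:Z)).
  have -> : k - n%:Z - 1 = k - n.+1%:Z by lia.
  by rewrite exprSr; ring.
apply/eqP; rewrite -subr_eq0 -normr_eq0 eq_le normr_ge0 andbT.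
have c : (fun n => (C + D) * p ^+ n) @ \oo --> (0 : R).
  by apply: cvg_geometric; rewrite ger0_norm.
rewrite -(cvg_lim _ c) //; apply: limr_ge; first exact: cvgP c.
apply: nearW => n; rewrite (hn n) normrM (ger0_norm (exprn_ge0 _ p0)) [leRHS]mulrC.
apply: ler_wpM2l; first exact: exprn_ge0.
apply: (le_trans (ler_normB _ _)).
by rewrite !ger0_norm // lerD.
Qed.

Lemma link_convolution t p b f : 0 <= p <= 1 -> (t <> TP -> p < 1) ->
  nonneg_summable b -> nonneg_summable f -> link t p b f ->
  f = convolution (kernel t p) b.
Proof.
move=> /andP[p0 p1] p1' sb sf; have [b0 _] := sb; case: t p1' => /= p1' hl.
- by apply: geometric_unique; rewrite ?p0 ?p1'.
- have := geometric_unique _ (nonneg_summable_reflection sb)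
    (nonneg_summable_reflection sf) (link_reflection hl).
  rewrite p0 p1' // => /(_ isT) e.
  have -> : f = reflection (reflection f).
    by apply/funext => k; rewrite /reflection opprK.
  rewrite e -convolution_reflection.
  + by congr convolution; apply/funext => k; rewrite /reflection opprK.
  + by have [] : nonneg_summable (geometric_seq p)
      by apply: nonneg_summable_geometric; rewrite p0 p1'.
  + by move=> k; apply: b0.
- apply/funext => k; rewrite convolutionE //; last first.
    by have [] := nonneg_summable_kernel (t := TP) (p := p)
      ltac:(by rewrite p0 p1) ltac:(by []).
  rewrite hl; pose u i x (j : int) : R := (j == i)%:R * x.
  have h0 : 0 <= p * b k by rewrite mulr_ge0.
  have h1 : 0 <= (1 - p) * b (k + 1) by rewrite mulr_ge0 ?subr_ge0.
  transitivity (fine (\esum_(j in [set: int]) ((u k (p * b k) j)%:E +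
    (u (k + 1) ((1 - p) * b (k + 1)) j)%:E)%E)).
    by rewrite esumD ?esum_dirac // => j _; rewrite lee_fin mulr_ge0.
  congr fine; apply: eq_esum => j _; rewrite -EFinD; congr EFin.
  rewrite /u /reflection /two_point_seq.
  have [->|jk] := eqVneq j k.
    have -> : (k == k + 1) = false by lia.
    by rewrite subrr oppr0 eqxx mul1r mul0r addr0.
  have -> : (- (k - j) == 0) = false by lia.
  have [->|jk1] := eqVneq j (k + 1).
    have -> : (- (k - (k + 1)) == 1) by lia.
    by rewrite mul1r mul0r add0r.
  have -> : (- (k - j) == 1) = false by lia.
  by rewrite !mul0r addr0.
Qed.

Lemma nonneg_summable_big_kernel t (ps : seq R) :
  (forall p, p \in ps -> 0 <= p <= 1 /\ (t <> TP -> p < 1)) ->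
  nonneg_summable (\big[convolution/unit_seq]_(p <- ps) kernel t p).
Proof.
elim: ps => [|p ps IH] h.
  rewrite big_nil; split=> [k|]; first by rewrite ler0n.
  rewrite /esumz (@eq_esum _ _ _ _ (fun j : int => ((j == 0)%:R * 1)%:E)).
    by rewrite esum_dirac ?ltry.
  by move=> j _; rewrite mulr1.
rewrite big_cons; have [h1 h2] := h p (mem_head _ _).
apply: nonneg_summable_convolution; first exact: nonneg_summable_kernel.
by apply: IH => q qps; apply: h; rewrite inE qps orbT.
Qed.

Lemma decomposable_nseq t n ts f : decomposable (nseq n t ++ ts) f ->
  nonneg_summable f -> exists (ps : seq R) b,
  [/\ (size ps <= n)%N /\
        (forall p, p \in ps -> 0 <= p <= 1 /\ (t <> TP -> 0 < p < 1)),
      nonneg_summable b, decomposable ts b &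
      f = convolution (\big[convolution/unit_seq]_(p <- ps) kernel t p) b].
Proof.
elim: n f => [|n IH] f /=.
  move=> df sf; exists [::], f; split=> //.
  by rewrite big_nil convolution_unit; have [] := sf.
move=> [p [b [hp p1 b0 hl db]]] sf.
have [f0 _] := sf.
have sb : nonneg_summable b.
  apply: nonneg_summable_le (nonneg_summableD sf (nonneg_summable_shift (- 1) sf)).
  by move=> k; rewrite b0 (link_le k hp b0 f0 hl).
have [ps [c [[sps hps] sc dc e]]] := IH b db sb.
have fe := link_convolution hp p1 sb sf hl.
(* A geometric factor with [p = 0] is the identity. It is dropped, as the parameters have to be
   positive; this is why [size ps] is only bounded by [n]. *)
have [p0|p0] := pselect (t <> TP /\ p = 0).
  exists ps, c; split=> //; first by split=> //; apply: leqW.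
  rewrite -e; apply/funext => k; have := hl k; case: p0 => tTP ->.
  by case: (t) tTP => // _; rewrite mul0r addr0.
exists (p :: ps), c; split=> //.
  split=> // q; rewrite inE => /orP[/eqP ->|/hps //]; split=> // tTP.
  rewrite p1 // andbT lt_neqAle; have /andP[-> _] := hp; rewrite andbT eq_sym.
  by apply/eqP => pe; apply: p0.
rewrite big_cons convolutionA //; first by rewrite -e.
  exact: nonneg_summable_kernel.
apply: nonneg_summable_big_kernel => q /hps[h1 h2]; split=> // /h2 /andP[_ //].
Qed.

End Convolution.

(** * Polynomials acting on sequences *)

Section Action.
Context {R : realType}.
Implicit Types (c p r : R) (P Q : {poly R}) (a b f : int -> R).

(** Multiplication by [P] of the formal two-sided series with coefficients [a], the indeterminate
    acting as the shift. *)
Definition act P a : int -> R := fun k => \sum_(i < size P) P`_i * a (k - i%:Z).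

Lemma act_widen n P a k : (size P <= n)%N ->
  act P a k = \sum_(i < n) P`_i * a (k - i%:Z).
Proof.
move=> Pn; rewrite /act (big_ord_widen n (fun i : nat => P`_i * a (k - i%:Z)) Pn).
rewrite big_mkcond; apply: eq_bigr => i _; case: ltnP => // Pi.
by rewrite nth_default // mul0r.
Qed.

Lemma actD P Q a k : act (P + Q) a k = act P a k + act Q a k.
Proof.
pose n := maxn (size P) (size Q).
rewrite !(@act_widen n) ?size_polyD ?leq_maxl ?leq_maxr // -big_split /=.
by apply: eq_bigr => i _; rewrite coefD mulrDl.
Qed.

Lemma actZ c P a k : act (c *: P) a k = c * act P a k.
Proof.
rewrite (@act_widen (size P)) ?size_scale_leq // mulr_sumr.
by apply: eq_bigr => i _; rewrite coefZ mulrA.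
Qed.

Lemma act_sum (I : Type) (s : seq I) (F : I -> {poly R}) a k :
  act (\sum_(i <- s) F i) a k = \sum_(i <- s) act (F i) a k.
Proof.
elim: s => [|i s IH]; last by rewrite !big_cons actD IH.
by rewrite !big_nil /act size_poly0 big_ord0.
Qed.

Lemma actC c a k : act c%:P a k = c * a k.
Proof.
rewrite (@act_widen 1) ?size_polyC ?leq_b1 // big_ord1 coefC eqxx.
by rewrite subr0.
Qed.

Lemma act1 a : act 1 a = a.
Proof. by apply/funext => k; rewrite actC mul1r. Qed.

Lemma act_mulX P a k : act (P * 'X) a k = act P a (k - 1).
Proof.
rewrite (@act_widen (size P).+1); last first.
  by apply: leq_trans (size_polyMleq _ _) _; rewrite size_polyX addn2.
rewrite big_ord_recl coefMX /= mul0r add0r; apply: eq_bigr => i _.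
by rewrite coefMX /= /bump /= add1n; congr (_ * a _); lia.
Qed.

Lemma actDr P a b k : act P (fun i => a i + b i) k = act P a k + act P b k.
Proof. by rewrite -big_split; apply: eq_bigr => i _; rewrite mulrDr. Qed.

Lemma actZr P c a k : act P (fun i => c * a i) k = c * act P a k.
Proof. by rewrite mulr_sumr; apply: eq_bigr => i _; rewrite mulrCA. Qed.

Lemma act_sumr (n : nat) P (F : 'I_n -> int -> R) k :
  act P (fun i => \sum_(j < n) F j i) k = \sum_(j < n) act P (F j) k.
Proof.
by rewrite exchange_big; apply: eq_bigr => i _; rewrite mulr_sumr.
Qed.

Lemma actM P Q a : act (P * Q) a = act P (act Q a).
Proof.
elim/poly_ind: P a => [|P c IH] a; apply/funext => k.
  by rewrite mul0r /act size_poly0 !big_ord0.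
rewrite mulrDl -mulrA -commr_polyX mulrA !actD !act_mulX IH !actC.
by rewrite mul_polyC actZ.
Qed.

Lemma actX a k : act 'X a k = a (k - 1).
Proof. by rewrite -['X]mul1r act_mulX act1. Qed.

Lemma act_XsubC r a k : act ('X - r%:P) a k = a (k - 1) - r * a k.
Proof. by rewrite -polyCN actD actX actC mulNr. Qed.

Definition bounded_seq a := exists C : R, forall k, `|a k| <= C.

Lemma bounded_act P a : bounded_seq a -> bounded_seq (act P a).
Proof.
move=> [C hC]; exists (\sum_(i < size P) `|P`_i| * C) => k.
apply: le_trans (ler_norm_sum _ _ _) _; apply: ler_sum => i _.
by rewrite normrM ler_wpM2l.
Qed.

Lemma bounded_seqD a b : bounded_seq a -> bounded_seq b ->
  bounded_seq (fun k => a k + b k).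
Proof.
move=> [C hC] [D hD]; exists (C + D) => k.
by apply: le_trans (ler_normD _ _) _; rewrite lerD.
Qed.

Lemma bounded_seqZ c a : bounded_seq a -> bounded_seq (fun k => c * a k).
Proof. by move=> [C hC]; exists (`|c| * C) => k; rewrite normrM ler_wpM2l. Qed.

Lemma bounded_seq_sum n (F : 'I_n -> int -> R) : (forall j, bounded_seq (F j)) ->
  bounded_seq (fun k => \sum_(j < n) F j k).
Proof.
move=> h; have /choice[C hC] := h.
exists (\sum_(j < n) C j) => k.
by apply: le_trans (ler_norm_sum _ _ _) _; apply: ler_sum => i _.
Qed.

(** The kernel of ['X - r] is spanned by the powers [r^(-k)], which are unbounded for positive [r]
    other than 1. Without boundedness only monomials would act injectively. *)
Definition injective_act P := forall a, bounded_seq a ->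
  (forall k, act P a k = 0) -> forall k, a k = 0.

Lemma injective_actM P Q : injective_act P -> injective_act Q ->
  injective_act (P * Q).
Proof.
move=> hP hQ a ba; rewrite actM => h; apply: hQ => //.
by apply: hP => //; apply: bounded_act.
Qed.

Lemma injective_actC c : c != 0 -> injective_act c%:P.
Proof.
move=> c0 a _ h k; have /eqP := h k.
by rewrite actC mulf_eq0 (negbTE c0) => /eqP.
Qed.

Lemma injective_actZ c P : c != 0 -> injective_act P -> injective_act (c *: P).
Proof.
by move=> c0 hP; rewrite -mul_polyC; apply: injective_actM (injective_actC c0) hP.
Qed.

Lemma injective_actX : injective_act 'X.
Proof. by move=> a _ h k; have := h (k + 1); rewrite actX addrK. Qed.

Lemma injective_actXn n : injective_act 'X^n.
Proof.
elim: n => [|n IH]; first by rewrite expr0; apply: injective_actC; apply: oner_neq0.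
by rewrite exprS; apply: injective_actM injective_actX IH.
Qed.

Lemma geometric_bound_eq0 (q C x : R) : 0 <= q < 1 ->
  (forall n, `|x| <= q ^+ n * C) -> x = 0.
Proof.
move=> /andP[q0 q1] h; apply/eqP; rewrite -normr_eq0 eq_le normr_ge0 andbT.
have c : (fun n => C * q ^+ n) @ \oo --> (0 : R).
  by apply: cvg_geometric; rewrite ger0_norm.
rewrite -(cvg_lim _ c) //; apply: limr_ge; first exact: cvgP c.
by apply: nearW => n; rewrite mulrC.
Qed.

Lemma injective_act_XsubC r : 0 < r -> r != 1 -> injective_act ('X - r%:P).
Proof.
move=> r0 r1 a [C hC] h k.
have e i : a (i - 1) = r * a i.
  by apply/eqP; rewrite -subr_eq0 -act_XsubC h.
have [rlt|rgt|rr] := ltgtP r 1; last by rewrite rr eqxx in r1.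
- have hn (n : nat) : a k = r ^+ n * a (k + n).
    elim: n => [|n ->]; first by rewrite expr0 mul1r addr0.
    rewrite exprSr -mulrA -e; congr (_ * a _); lia.
  have r0' := ltW r0.
  apply: (@geometric_bound_eq0 r C); first by rewrite r0' rlt.
  move=> n; rewrite (hn n) normrM (ger0_norm (exprn_ge0 n r0')).
  by rewrite ler_wpM2l ?exprn_ge0.
- have hn (n : nat) : a k = r^-1 ^+ n * a (k - n%:Z).
    elim: n => [|n ->]; first by rewrite expr0 mul1r subr0.
    have -> : k - n.+1%:Z = k - n%:Z - 1 by lia.
    by rewrite e exprSr -mulrA mulKf ?gt_eqF.
  have ri : 0 <= r^-1 by rewrite invr_ge0 ltW.
  apply: (@geometric_bound_eq0 r^-1 C); first by rewrite ri invf_lt1.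
  move=> n; rewrite (hn n) normrM (ger0_norm (exprn_ge0 n ri)).
  by rewrite ler_wpM2l ?exprn_ge0.
Qed.

Lemma injective_act_prod n (r : nat -> R) (A : pred nat) :
  (forall i, (i < n)%N -> 0 < r i /\ r i != 1) ->
  injective_act (\prod_(i < n | A i) ('X - (r i)%:P)).
Proof.
elim: n => [|n IH] h.
  by rewrite big_ord0; apply: injective_actC; apply: oner_neq0.
rewrite big_mkcond big_ord_recr -big_mkcond /=; apply: injective_actM.
  by apply: IH => i ni; apply: h; apply: ltnW.
case: ifP => _; last by apply: injective_actC; apply: oner_neq0.
by have [? ?] := h n (leqnn _); apply: injective_act_XsubC.
Qed.

Lemma injective_act_eq P a b : injective_act P -> bounded_seq a -> bounded_seq b ->
  (forall k, act P a k = act P b k) -> forall k, a k = b k.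
Proof.
move=> hP ba bb h k; apply/eqP; rewrite -subr_eq0; apply/eqP.
have e i : a i - b i = a i + (-1) * b i by rewrite mulN1r.
rewrite e; move: k; apply: (hP (fun k => a k + -1 * b k)).
  by apply: bounded_seqD => //; apply: bounded_seqZ.
by move=> k; rewrite actDr actZr mulN1r h subrr.
Qed.

End Action.

(** * Continuants and Euler's identity *)

Section Continuant.
Context {T : comNzRingType}.

Fixpoint continuant (x : T) (c : nat -> T) (j : nat) : T :=
  if j is j1.+1 then
    if j1 is j2.+1 then x * continuant x c j1 - c j2 * continuant x c j2 else x
  else 1.

Lemma continuantSS x c j :
  continuant x c j.+2 = x * continuant x c j.+1 - c j * continuant x c j.
Proof. by []. Qed.

(** The continuants started at 0 and those started at [m + 1] solve the same three-term recurrence.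
    The left side is their Casorati determinant, which every step multiplies by one coupling. *)
Lemma continuant_euler x c m l :
  continuant x (fun i => c (m.+1 + i)%N) l.+1 * continuant x c (m + l).+1 -
  continuant x c (m + l).+2 * continuant x (fun i => c (m.+1 + i)%N) l =
  (\prod_(i < l.+1) c (m + i)%N) * continuant x c m.
Proof.
elim: l => [|l IH].
  by rewrite addn0 big_ord1 addn0 continuantSS /=; ring.
rewrite big_ord_recr mulrAC -IH [val ord_max]/= !addnS.
rewrite [continuant _ _ (m + l).+3]continuantSS [continuant _ _ l.+2]continuantSS.
rewrite addSn; ring.
Qed.

End Continuant.

(** * Sturm sequences *)

Section Sturm.
Context {R : realType}.
Implicit Types (p q P Q : {poly R}) (r x t : nat -> R).

(* [sturm C j] is ['X^(j./2)] times the continuant with couplings [C i / 'X]. *)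
Fixpoint sturm (C : nat -> {poly R}) (j : nat) : {poly R} :=
  if j is j1.+1 then
    if j1 is j2.+1 then 'X^(~~ odd j2) * sturm C j1 - C j2 * sturm C j2 else 1
  else 1.

Lemma sturmSS C j :
  sturm C j.+2 = 'X^(~~ odd j) * sturm C j.+1 - C j * sturm C j.
Proof. by []. Qed.
Arguments sturm : simpl never.

Lemma nat_ind2 (A : nat -> Prop) : A 0%N -> A 1%N ->
  (forall j, A j -> A j.+1 -> A j.+2) -> forall j, A j.
Proof.
move=> h0 h1 h2 j; suff : A j /\ A j.+1 by case.
by elim: j => // j [? ?]; split=> //; apply: h2.
Qed.

Lemma continuant_sturm C j :
  continuant 'X (fun i => 'X * C i) j = 'X^(uphalf j) * sturm C j.
Proof.
elim/nat_ind2: j => [|| j IH0 IH1]; first by rewrite mul1r.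
  by rewrite mulr1.
rewrite continuantSS IH0 IH1 sturmSS.
have -> : uphalf j.+2 = (uphalf j).+1 by [].
have -> : uphalf j.+1 = (~~ odd j + uphalf j)%N by rewrite uphalf_half /=; lia.
by rewrite exprD exprS; ring.
Qed.

Lemma coef_mul_top p q m n : (size p <= m.+1)%N -> (size q <= n.+1)%N ->
  (p * q)`_(m + n) = p`_m * q`_n.
Proof.
move=> hp hq; rewrite coefM.
have hm : (m < (m + n).+1)%N by lia.
rewrite (bigD1 (Ordinal hm)) //= addKn big1 ?addr0 // => i im.
have /orP[h|h] : (m < i)%N || (n < m + n - i)%N.
- have : nat_of_ord i != m by apply: contra im => /eqP e; apply/eqP/val_inj.
  by have := ltn_ord i; lia.
- by rewrite [p`_i]nth_default ?mul0r //; apply: leq_trans hp _.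
- by rewrite [q`__]nth_default ?mulr0 //; apply: leq_trans hq _.
Qed.

Lemma sign_prod_XsubC r (t : R) n m : (m <= n)%N ->
  (forall k, (k < m)%N -> r k < t) -> (forall k, (m <= k < n)%N -> t < r k) ->
  0 < (-1) ^+ (n + m) * \prod_(k < n) (t - r k).
Proof.
elim: n m => [|n IH] m.
  by rewrite leqn0 => /eqP -> _ _; rewrite big_ord0 mulr1 ltr01.
rewrite leq_eqVlt => /orP[/eqP -> hl _|mn hl hr].
  rewrite addnn -signr_odd odd_double expr0 mul1r; apply: prodr_gt0 => i _.
  by rewrite subr_gt0 hl.
have h := IH m mn hl (fun k hk => hr k ltac:(lia)).
rewrite big_ord_recr /= addSn exprS mulN1r mulNr mulrA -mulrN opprB.
by rewrite mulr_gt0 // subr_gt0 hr //; lia.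
Qed.

Lemma sign_prod_diff r n k : (k < n)%N -> (forall i j, (i < j < n)%N -> r i < r j) ->
  0 < (-1) ^+ (n + k).+1 * \prod_(l < n | (l != k :> nat)) (r k - r l).
Proof.
elim: n => // n IH; rewrite ltnS leq_eqVlt => /orP[/eqP -> hr|kn hr].
  rewrite addSn addnn -signr_odd /= odd_double expr0 mul1r.
  by apply: prodr_gt0 => i ik; rewrite subr_gt0 hr //; have := ltn_ord i; lia.
have h := IH kn (fun i j hij => hr i j ltac:(lia)).
rewrite big_mkcond big_ord_recr -big_mkcond /= ifT; last by lia.
rewrite !addSn exprS mulN1r mulNr mulrA -mulrN opprB -addSn addSn.
by rewrite mulr_gt0 // subr_gt0 hr //; lia.
Qed.

Lemma uniq_increasing r n : (forall i j, (i < j < n)%N -> r i < r j) ->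
  uniq [seq r k | k <- iota 0 n].
Proof.
move=> hr; rewrite map_inj_in_uniq ?iota_uniq // => i j.
rewrite !mem_iota /= add0n => hi hj rij; have [ij|ij|//] := ltngtP i j.
- by have := hr i j; rewrite ij hj rij ltxx => /(_ isT).
- by have := hr j i; rewrite ij hi rij ltxx => /(_ isT).
Qed.

Lemma prod_XsubC_iota r n : \prod_(z <- [seq r k | k <- iota 0 n]) ('X - z%:P) =
  \prod_(k < n) ('X - (r k)%:P).
Proof.
rewrite big_map; have -> : iota 0 n = index_iota 0 n by rewrite /index_iota subn0.
by rewrite big_mkord.
Qed.

(** One root in each of [n] disjoint intervals exhausts the degree. *)
Lemma roots_between p x n :
  (size p <= n.+1)%N -> (forall k, (k < n)%N -> x k < x k.+1) ->
  (forall k, (k < n)%N -> p.[x k] * p.[x k.+1] < 0) -> p != 0 ->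
  exists t, (forall k, (k < n)%N -> x k < t k < x k.+1) /\
    p = lead_coef p *: \prod_(k < n) ('X - (t k)%:P).
Proof.
move=> sp xS ps p0.
have /choice[t ht] : forall k, exists y : R,
    (k < n)%N -> x k < y < x k.+1 /\ root p y.
  move=> k; have [kn|] := ltnP k n; last by exists 0.
  have [t] := polyrcf.poly_ivtoo (ltW (xS k kn)) (ps k kn).
  by rewrite in_itv /= => ? ?; exists t.
exists t; split=> [k /ht[]//|].
have tlt k (d : nat) : (k + d.+1 < n)%N -> t k < t (k + d.+1)%N.
  have step l : (l.+1 < n)%N -> t l < t l.+1.
    move=> ln; have [/andP[_ h1] _] := ht l ltac:(lia).
    by have [/andP[h2 _] _] := ht l.+1 ln; apply: lt_trans h1 h2.
  elim: d => [|d IH] h; first by rewrite addn1 step // -addn1.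
  apply: (lt_trans (IH ltac:(lia))).
  by rewrite [(k + d.+2)%N]addnS; apply: step; lia.
pose s := [seq t k | k <- iota 0 n].
have ss : size s = n by rewrite size_map size_iota.
have us : uniq s.
  apply: uniq_increasing => i j /andP[ij jn].
  have := @tlt i (j - i).-1; rewrite (_ : i + _ = j)%N; last by lia.
  exact.
have rs : all (root p) s.
  apply/allP => y /mapP[k]; rewrite mem_iota add0n => /andP[_ kn] ->.
  by have [] := ht k kn.
have sz : size p = (size s).+1.
  by apply/eqP; rewrite eqn_leq {1}ss sp max_poly_roots.
rewrite {1}(all_roots_prod_XsubC sz rs); last by rewrite uniq_rootsE.
by rewrite prod_XsubC_iota.
Qed.

(* Half of the roots lie in (0,1) and half in (1,oo); the last clause encodes
   that, moving outwards from 1, the roots of [p] and [q] strictly alternate. *)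
Definition sturm_roots (n : nat) r p q : Prop :=
  [/\ forall k, (k < n.*2)%N -> 0 < r k,
      forall k, (k < n.*2)%N -> if (k < n)%N then r k < 1 else 1 < r k,
      forall i j, (i < j < n.*2)%N -> r i < r j,
      p = lead_coef p *: \prod_(k < n.*2) ('X - (r k)%:P) &
      forall k, (k < n.*2)%N -> 0 < (-1) ^+ (n + k + (k < n)) * q.[r k]].

(** The signs of [p] alternate along [n.*2 + 1] points with 1 in the middle, so each gap holds
    exactly one root and half of the roots lie below 1. *)
Lemma sturm_roots_step n x p q : (size p <= n.*2.+1)%N -> 0 <= x 0%N ->
  (forall k, (k < n.*2)%N -> x k < x k.+1) -> x n = 1 ->
  (forall k, (k <= n.*2)%N -> 0 < (-1) ^+ (k + n) * p.[x k]) ->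
  (forall k (w : R), (k < n.*2)%N -> x k < w -> w < x k.+1 ->
     0 < (-1) ^+ (n + k + (k < n)) * q.[w]) ->
  exists r, sturm_roots n r p q.
Proof.
move=> sp x0 xS xn px qx.
have xmono i d : (i + d <= n.*2)%N -> x i <= x (i + d)%N.
  elim: d => [|d IH] h; first by rewrite addn0.
  apply: (le_trans (IH ltac:(lia))); rewrite addnS; apply: ltW.
  by apply: xS; lia.
have xle i j : (i <= j <= n.*2)%N -> x i <= x j.
  by move=> h; have := @xmono i (j - i)%N; rewrite subnKC; [apply|]; lia.
have p0 : p != 0.
  by apply/eqP => p0; have := px 0%N isT; rewrite p0 horner0 mulr0 ltxx.
have [k kn|t [ht pt]] := roots_between sp xS _ p0.
  have := px k ltac:(lia); have := px k.+1 kn; rewrite addSn exprS mulN1r.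
  move: (sign_cases (R := R) (k + n)) => [] ->; rewrite ?mulN1r ?opprK ?mul1r ?oppr_gt0.
    by move=> h1 h2; rewrite pmulr_rlt0.
  by move=> h1 h2; rewrite nmulr_rlt0.
exists t; split => // [k kn|k kn|i j ij|k kn].
- have /andP[h _] := ht k kn; apply: le_lt_trans h.
  by apply: (le_trans x0); apply: xle; lia.
- have /andP[h1 h2] := ht k kn; case: ltnP => kn'.
    by apply: (lt_le_trans h2); rewrite -xn; apply: xle; lia.
  by apply: (le_lt_trans _ h1); rewrite -xn; apply: xle; lia.
- have /andP[_ h1] := ht i ltac:(lia); have /andP[h2 _] := ht j ltac:(lia).
  by apply: (lt_trans h1); apply: le_lt_trans h2; apply: xle; lia.
- by have /andP[h1 h2] := ht k kn; apply: qx h1 h2.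
Qed.

Lemma half_succ j : j.+1./2 = (odd j + j./2)%N.
Proof. by rewrite -uphalfE uphalf_half. Qed.

Section SturmChain.
Context (C : nat -> {poly R}).
Hypothesis C_size : forall j, (size (C j) <= 3)%N.
Hypothesis C_lead : forall j, 0 < (C j)`_2.
Hypothesis C_pos : forall j (w : R), 0 <= w -> 0 < (C j).[w].
Hypothesis sturm_1 : forall j, 0 < (sturm C j).[1].

Lemma size_sturm j : (size (sturm C j) <= (j./2).*2.+1)%N.
Proof.
elim/nat_ind2: j => [|| j IH0 IH1]; rewrite ?size_poly1 // sturmSS.
apply: leq_trans (size_polyD _ _) _; rewrite size_polyN geq_max; apply/andP; split.
  rewrite mulrC; move: IH1; rewrite half_succ; case: (odd j) => IH1.
    by rewrite expr0 mulr1; apply: leq_trans IH1 _; rewrite /= ; lia.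
  apply: leq_trans (size_polyMleq _ _) _; rewrite size_polyX addn2 /=.
  by move: IH1; rewrite add0n; move: (size _) => u; rewrite doubleS; lia.
apply: leq_trans (size_polyMleq _ _) _; have := C_size j; move: IH0.
rewrite /= doubleS; move: (size _) (size _) => u v; lia.
Qed.

(** The two terms of the recurrence never cancel in top degree: for odd [j] both contribute with the
    same sign, for even [j] the term multiplied by ['X] has too small a degree. The same happens at
    0 in [sturm_0], where for even [j] the factor ['X] vanishes. *)
Lemma lead_sturm j : 0 < (-1) ^+ (j./2) * (sturm C j)`_((j./2).*2).
Proof.
elim/nat_ind2: j => [|| j IH0 IH1]; rewrite ?expr0 ?mul1r ?coef1 ?ltr01 //.
rewrite sturmSS coefB mulrBr.
have -> : (j.+2./2).*2 = (2 + (j./2).*2)%N by rewrite /= doubleS; lia.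
rewrite (@coef_mul_top (C j)) ?size_sturm //.
have -> : j.+2./2 = (j./2).+1 by [].
rewrite exprS mulN1r !mulNr opprK.
apply: ltr_wpDl; last by rewrite mulrCA mulr_gt0.
have [jo|je] := boolP (odd j); rewrite ?expr0 ?mul1r.
  move: IH1; have -> : j.+1./2 = (j./2).+1 by rewrite half_succ jo.
  rewrite exprS mulN1r mulNr => h; apply: ltW; move: h.
  by rewrite doubleS -[(_.*2).+2]add2n.
rewrite expr1 coefXM /= [_`__]nth_default ?mulr0 ?oppr0 //.
by apply: leq_trans (size_sturm _) _; rewrite half_succ (negbTE je).
Qed.

Lemma sturm_0 j : 0 < (-1) ^+ (j./2) * (sturm C j).[0].
Proof.
elim/nat_ind2: j => [|| j IH0 IH1]; rewrite ?expr0 ?mul1r ?hornerC ?ltr01 //.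
rewrite sturmSS !hornerE.
have -> : j.+2./2 = (j./2).+1 by [].
rewrite exprS mulN1r mulrBr !mulNr opprK.
apply: ltr_wpDl; last by rewrite mulrCA mulr_gt0 // C_pos.
have [jo|je] := boolP (odd j); rewrite ?expr0 ?mul1r.
  move: IH1; have -> : j.+1./2 = (j./2).+1 by rewrite half_succ jo.
  by rewrite exprS mulN1r mulNr => h; apply: ltW; move: h; rewrite ?mul1r.
by rewrite expr1 mul0r mulr0 oppr0.
Qed.

Lemma sign_eq (a b : nat) : odd a = odd b -> (-1) ^+ a = (-1) ^+ b :> R.
Proof. by move=> e; rewrite -signr_odd e signr_odd. Qed.

Lemma sturm_sign_between n r p q (t : R) m : sturm_roots n r p q ->
  0 < (-1) ^+ n * lead_coef p -> (m <= n.*2)%N ->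
  (forall l, (l < m)%N -> r l < t) ->
  (forall l, (m <= l < n.*2)%N -> t < r l) -> 0 < (-1) ^+ (n + m) * p.[t].
Proof.
move=> [_ _ _ pE _] hp hm hl hr.
have pt : p.[t] = lead_coef p * \prod_(k < n.*2) (t - r k).
  rewrite {1}pE hornerZ horner_prod; congr (_ * _).
  by apply: eq_bigr => k _; rewrite !hornerE.
rewrite pt; have := mulr_gt0 hp (sign_prod_XsubC hm hl hr); congr (0 < _).
by rewrite mulrACA -exprD; congr (_ * _); apply: sign_eq; lia.
Qed.

Lemma lead_coef_sturm j : 0 < (-1) ^+ (j./2) * lead_coef (sturm C j).
Proof.
have h := lead_sturm j.
suff sz : size (sturm C j) = (j./2).*2.+1 by rewrite lead_coefE sz.
apply/eqP; rewrite eqn_leq size_sturm /= ltnNge; apply/negP => le.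
by move: h; rewrite nth_default // mulr0 ltxx.
Qed.

Lemma sturm_large j (B : R) : exists2 M : R, B < M & 0 < (-1) ^+ (j./2) * (sturm C j).[M].
Proof.
have h := lead_coef_sturm j.
have [|M hM] := @polyrcf.poly_pinfty_gt_lc R ((-1) ^+ (j./2) *: sturm C j).
  by rewrite lead_coefZ.
exists (Num.max M (B + 1)).
  by rewrite lt_max ltrDl ltr01 orbT.
rewrite -hornerZ; apply: lt_le_trans (hM _ _); first by rewrite lead_coefZ.
by rewrite le_max lexx.
Qed.

(** At a root of [sturm C i.+1] the recurrence gives [sturm C i.+2] the sign opposite to that of
    [sturm C i], which is known by induction. The value at 1 is positive by hypothesis and supplies
    the sign change that the alternation of roots leaves out around 1. *)
Lemma sturm_rootsP j : exists r, sturm_roots (j.+1./2) r (sturm C j.+1) (sturm C j).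
Proof.
elim: j => [|i [r hr]].
  exists (fun=> 0); rewrite -[1./2]/0%N; split=> //; first by move=> i j /andP[_].
  by rewrite big_ord0 -[sturm C 1]/(1 : {poly R}) lead_coef1 scale1r.
have hlead := lead_coef_sturm i.+1.
have hsz := size_sturm i.+2.
have h0 := sturm_0 i.+2.
have hlarge := sturm_large i.+2.
have half2 : (i.+2./2 = ~~ odd i + i.+1./2)%N by rewrite half_succ.
set n := i.+1./2 in hr hlead half2 *.
have [r0 r1 rS pE rq] := hr.
(* The roots of [sturm C i.+1] with the point 1 inserted in the middle. *)
pose y k := if (k < n)%N then r k else if k == n then 1 else r k.-1.
have yn : y n = 1 by rewrite /y ltnn eqxx.
have yl k : (k < n)%N -> y k = r k by rewrite /y => ->.
have yr k : (n < k)%N -> y k = r k.-1.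
  by rewrite /y => h; rewrite ifF ?ifF //; lia.
have rl k : (k < n)%N -> r k < 1 by move=> h; have := r1 k; rewrite h; apply; lia.
have rr k : (n <= k < n.*2)%N -> 1 < r k.
  by move=> /andP[h h']; have := r1 k h'; rewrite ltnNge h.
have yS k : (k < n.*2)%N -> y k < y k.+1.
  move=> kn; have [h|h|h] := ltngtP k n.
  - rewrite yl //; have [h'|h'|h'] := ltngtP k.+1 n; last by rewrite h' yn rl.
      by rewrite yl // rS //; lia.
    lia.
  - by rewrite !yr ?rS //; lia.
  - by rewrite h yn yr ?rr //; lia.
have y0 k : (k <= n.*2)%N -> 0 < y k.
  move=> kn; have [h|h|h] := ltngtP k n.
  - by rewrite yl // r0 //; lia.
  - by rewrite yr // r0 //; lia.
  - by rewrite h yn.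
have root_eval k : (k < n.*2)%N -> (sturm C i.+2).[r k] = - ((C i).[r k] * (sturm C i).[r k]).
  move=> kn; rewrite sturmSS !hornerE.
  have -> : (sturm C i.+1).[r k] = 0.
    rewrite pE hornerZ horner_prod (bigD1 (Ordinal kn)) //= hornerXsubC subrr mul0r.
    by rewrite mulr0.
  by rewrite mulr0 add0r.
have Cpos k : (k < n.*2)%N -> 0 < (C i).[r k] by move=> kn; apply/C_pos/ltW/r0.
have ysign k : (k <= n.*2)%N -> 0 < (-1) ^+ (k + n) * (sturm C i.+2).[y k].
  move=> kn; have [h|h|h] := ltngtP k n.
  - have kn' : (k < n.*2)%N by lia.
    have := rq k kn'; rewrite h addn1 yl // root_eval // => hs.
    rewrite mulrN -mulNr mulrCA mulr_gt0 ?Cpos //.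
    by move: hs; rewrite exprS mulN1r addnC.
  - have kn' : (k.-1 < n.*2)%N by lia.
    have := rq _ kn'; rewrite ltnNge (_ : n <= k.-1)%N ?addn0 /=; last by lia.
    rewrite yr // root_eval // => hs.
    rewrite mulrN -mulNr mulrCA mulr_gt0 ?Cpos //.
    move: hs; have -> : (k + n = (n + k.-1).+1)%N by lia.
    by rewrite exprS mulN1r opprK.
  - by rewrite h yn addnn -signr_odd odd_double expr0 mul1r.
have between k (t : R) : (k < n.*2)%N -> y k < t -> t < y k.+1 ->
    0 < (-1) ^+ (n + (k + (k < n))) * (sturm C i.+1).[t].
  move=> kn h1 h2; apply: (sturm_sign_between hr hlead); first lia.
  - move=> l lk; apply: le_lt_trans h1.
    have [h|h|h] := ltngtP k n.
    + rewrite yl //; move: lk; rewrite h addn1 ltnS leq_eqVlt => /orP[/eqP -> //|lk].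
      by apply/ltW/rS; lia.
    + rewrite yr //; have [->//|lk'] := eqVneq l k.-1.
      by apply/ltW/rS; lia.
    + by rewrite h yn; apply/ltW/rl; lia.
  - move=> l lk; apply: (lt_le_trans h2).
    have [h|h] := ltnP k n.
      have [h'|h'] := ltnP k.+1 n.
        rewrite yl //; have [->//|lk'] := eqVneq l k.+1.
        by apply/ltW/rS; lia.
      have -> : k.+1 = n by lia.
      by rewrite yn; apply/ltW/rr; lia.
    rewrite yr ?ltnS //=; have [->//|lk'] := eqVneq l k.
    by apply/ltW/rS; lia.
(* For odd [i] the degree does not grow, and the gaps between the points [y] hold all the roots. *)
have [io|ie] := boolP (odd i).
  rewrite half2 io add0n in h0 hsz hlarge *.
  apply: (@sturm_roots_step n y) => //.
    exact/ltW/y0.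
  by move=> k t kn h1 h2; rewrite -addnA; apply: between.
rewrite half2 ie /= add1n in h0 hsz hlarge *.
have [M yM hM] := hlarge (y n.*2).
(* For even [i] the degree grows by 2. The two new roots lie outside the old ones, and are caught by
   adding the point 0 on the left and a large [M] on the right. *)
pose x k := if k is k'.+1 then if (k' <= n.*2)%N then y k' else M else 0.
apply: (@sturm_roots_step n.+1 x) => //.
- move=> [_|k kn] /=; first exact: y0.
  rewrite /x ifT; last by lia.
  case: ifPn => h; first by apply: yS.
  by have -> : k = n.*2 by lia.
- by rewrite /x ifT //; lia.
- move=> [_|k kn] /=; first by rewrite add0n.
  case: ifPn => h.
    have := ysign k h; congr (0 < _ * _); apply: sign_eq; lia.
  by move: hM; congr (0 < _ * _); apply: sign_eq; lia.
- move=> [|k] t kn.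
    rewrite /x /= => _ h2.
    have := @sturm_sign_between _ _ _ _ t 0 hr hlead isT.
    have -> : (-1) ^+ (n + 0) = (-1) ^+ (n.+1 + 0 + (0 < n.+1)%N) :> R by apply: sign_eq; lia.
    apply => // l hl; apply: (lt_le_trans h2).
    have [n0|n0] := posnP n; first lia.
    rewrite yl //; have [->//|l0] := eqVneq l 0%N.
    by apply/ltW/rS; lia.
  rewrite /x ifT; last by lia.
  case: ifPn => h h1 h2.
    have := between k t h h1 h2; congr (0 < _ * _); apply: sign_eq; lia.
  have kE : k = n.*2 by lia.
  have := @sturm_sign_between _ _ _ _ t n.*2 hr hlead (leqnn _).
  have -> : (-1) ^+ (n + n.*2) = (-1) ^+ (n.+1 + k.+1 + (k.+1 < n.+1)%N) :> R.
    by apply: sign_eq; lia.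
  apply; last by move=> l; lia.
  move=> l hl; apply: le_lt_trans h1; rewrite kE.
  have [n0|n0] := posnP n; first lia.
  rewrite yr; last by lia.
  have [->//|l0] := eqVneq l (n.*2.-1).
  by apply/ltW/rS; lia.
Qed.

End SturmChain.

End Sturm.

(** * Partial fractions *)

Section PartialFractions.
Context {R : realType}.
Implicit Types (N P : {poly R}) (r rho : nat -> R) (a : int -> R).

Lemma cofactor_eval n r (k : nat) : (k < n)%N ->
  (forall i j, (i < j < n)%N -> r i < r j) ->
  forall l, (l < n)%N ->
  (\prod_(i < n | i != l :> nat) ('X - (r i)%:P)).[r k] =
  if k == l then \prod_(i < n | i != k :> nat) (r k - r i) else 0.
Proof.
move=> kn hr l ln; rewrite horner_prod; case: eqVneq => [<-|kl].
  by apply: eq_bigr => i _; rewrite hornerXsubC.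
by rewrite (bigD1 (Ordinal kn)) //= hornerXsubC subrr mul0r.
Qed.

Lemma cofactor_neq0 n r (k : nat) : (k < n)%N ->
  (forall i j, (i < j < n)%N -> r i < r j) ->
  \prod_(i < n | i != k :> nat) (r k - r i) != 0.
Proof.
move=> kn hr; have := sign_prod_diff kn hr.
by apply: contraTneq => ->; rewrite mulr0 ltxx.
Qed.

Lemma size_prod_XsubC_lt n r (A : pred nat) l : (l < n)%N -> ~~ A l ->
  (size (\prod_(i < n | A i) ('X - (r i)%:P) : {poly R})%R <= n)%N.
Proof.
move=> ln Al; rewrite size_prod; last first.
  by move=> i _; rewrite polyXsubC_eq0.
rewrite (eq_bigr (fun=> 2%N)); last by move=> i _; rewrite size_XsubC.
rewrite sum_nat_const.
have : (#|(fun i : 'I_n => A i)| < n)%N.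
  rewrite -[X in (_ < X)%N]card_ord; apply: proper_card; apply/properP.
  split; first exact: subset_predT.
  by exists (Ordinal ln).
by move: #|_| => u; lia.
Qed.

(** The constant term matches the coefficient of degree [n], so the difference of the two sides has
    degree below [n], and it vanishes at the [n] points [r k]. *)
Lemma partial_fractions n r N (kappa : R) : kappa != 0 ->
  (forall i j, (i < j < n)%N -> r i < r j) -> (size N <= n.+1)%N ->
  let cof k := \prod_(i < n | i != k :> nat) ('X - (r i)%:P) in
  let rho k := N.[r k] / (kappa * \prod_(i < n | i != k :> nat) (r k - r i)) in
  N = (N`_n / kappa) *: (kappa *: \prod_(i < n) ('X - (r i)%:P)) +
      \sum_(k < n) rho k *: (kappa *: cof k).
Proof.
move=> k0 hr sN cof rho; apply/eqP; rewrite -subr_eq0; apply/eqP.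
set D := _ - _.
pose s := [seq r k | k <- iota 0 n].
have us : uniq s by apply: uniq_increasing.
have scof k : (k < n)%N -> (size (cof k) <= n)%N.
  by move=> kn; apply: (@size_prod_XsubC_lt _ _ (fun i => i != k) k) => //; rewrite eqxx.
have prodE := prod_XsubC_iota r n.
have ss : size s = n by rewrite size_map size_iota.
have monprod : (\prod_(i < n) ('X - (r i)%:P))`_n = 1.
  have := monic_prod_XsubC s predT id; rewrite -prodE.
  by move/monicP; rewrite lead_coefE size_prod_XsubC ss.
have sD : (size D <= n)%N.
  apply/leq_sizeP => j; rewrite leq_eqVlt => /orP[/eqP <-|nj].
    rewrite coefB coefD !coefZ monprod mulr1 divfK // coef_sum big1 ?addr0 ?subrr //.
    by move=> k _; rewrite !coefZ [_`_n]nth_default ?scof // !mulr0.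
  rewrite nth_default //; apply: leq_trans nj.
  apply: leq_trans (size_polyD _ _) _; rewrite size_polyN geq_max sN /=.
  apply: leq_trans (size_polyD _ _) _; rewrite geq_max; apply/andP; split.
    apply: leq_trans (size_scale_leq _ _) _; apply: leq_trans (size_scale_leq _ _) _.
    by rewrite -prodE size_prod_XsubC ss.
  apply: leq_trans (size_sum _ _ _) _; apply/bigmax_leqP => k _.
  apply: leq_trans (size_scale_leq _ _) _; apply: leq_trans (size_scale_leq _ _) _.
  by apply: leqW; apply: scof.
apply: (@roots_geq_poly_eq0 _ _ s) => //; last by rewrite ss.
apply/allP => y /mapP[k]; rewrite mem_iota add0n => /andP[_ kn] ->.
rewrite /root /D hornerD hornerN hornerD !hornerZ horner_prod.
rewrite (bigD1 (Ordinal kn)) //= hornerXsubC subrr mul0r !mulr0 add0r.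
rewrite horner_sum (bigD1 (Ordinal kn)) //= big1 ?addr0; last first.
  move=> l lk; rewrite !hornerZ (cofactor_eval kn hr) // ifF ?mulr0 //.
  by apply/negP => /eqP kl; case/eqP: lk; apply/val_inj.
rewrite !hornerZ (cofactor_eval kn hr) // eqxx /rho.
by rewrite divfK ?subrr // mulf_neq0 ?cofactor_neq0.
Qed.

(** These are the moments of a discrete measure on [0,1]: each difference multiplies the mass at [s]
    by [s - 1]. A mass at [s = 0] gives a term at [k = 0] only. *)
Lemma completely_monotone_sum n (m s : nat -> R) :
  (forall i, (i < n)%N -> 0 <= m i /\ 0 <= s i <= 1) ->
  completely_monotone (fun k => \sum_(i < n) m i * s i ^+ k).
Proof.
move=> h d k.
have -> : iter d diffn (fun k => \sum_(i < n) m i * s i ^+ k) k =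
    \sum_(i < n) m i * s i ^+ k * (s i - 1) ^+ d.
  elim: d k => [|d IH] k /=.
    by apply: eq_bigr => i _; rewrite expr0 mulr1.
  rewrite /diffn !IH -sumrB; apply: eq_bigr => i _.
  by rewrite !exprS; ring.
rewrite mulr_sumr; apply: sumr_ge0 => i _; have [m0 /andP[s0 s1]] := h i (ltn_ord i).
rewrite mulrCA -exprMn mulN1r opprB.
by rewrite !mulr_ge0 ?exprn_ge0 // subr_ge0.
Qed.

Lemma completely_monotoneD (c d : nat -> R) : completely_monotone c ->
  completely_monotone d -> completely_monotone (fun k => c k + d k).
Proof.
move=> hc hd n k.
have -> : iter n diffn (fun k => c k + d k) k = iter n diffn c k + iter n diffn d k.
  by elim: n k => //= n IH k; rewrite /diffn !IH; ring.
by rewrite mulrDr addr_ge0.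
Qed.

Lemma completely_monotone_ext (c d : nat -> R) : (forall k, c k = d k) ->
  completely_monotone d -> completely_monotone c.
Proof. by move=> e hd; have -> : c = d by apply/funext. Qed.

Lemma completely_monotone0 (m : R) : 0 <= m ->
  completely_monotone (fun k => m * (k == 0%N)%:R).
Proof.
move=> m0; apply: (@completely_monotone_ext _ (fun k => \sum_(i < 1) m * 0 ^+ k)).
  by move=> k; rewrite big_ord1 expr0n.
by apply: (@completely_monotone_sum 1 (fun=> m) (fun=> 0)) => i _; rewrite lexx ler01.
Qed.

(* The bounded sequence with [('X - r) e = unit_seq], the Laurent expansion of
   [1 / (w - r)] on the unit circle. *)
Definition simple_pole (r : R) : int -> R := fun k =>
  if r < 1 then (if k < 0 then r ^+ (absz k).-1 else 0)
  else if 0 <= k then - r^-1 ^+ (absz k).+1 else 0.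

Lemma act_simple_pole (r : R) : 0 < r -> r != 1 ->
  act ('X - r%:P) (simple_pole r) = unit_seq.
Proof.
move=> r0 r1; apply/funext => k; rewrite act_XsubC /simple_pole /unit_seq.
have rn0 : r != 0 by rewrite gt_eqF.
case: ifPn => hr.
  have [k0|k0|->] := ltgtP k 0.
  - have -> : k - 1 < 0 by lia.
    have -> : (absz (k - 1)%R).-1 = (absz k).-1.+1 by lia.
    by rewrite exprS subrr.
  - have -> : k - 1 < 0 = false by lia.
    by rewrite mulr0 subr0.
  - by rewrite mulr0 subr0.
have [k0|k0|->] := ltgtP k 0.
- have -> : 0 <= k - 1 = false by lia.
  by rewrite mulr0 subr0.
- have -> : 0 <= k - 1 by lia.
  have -> : (absz (k - 1)%R).+1 = absz k by lia.
  by rewrite mulrN exprS mulrA divff // mul1r subrr.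
- by rewrite /= expr1 mulrN divff // opprK add0r.
Qed.

Lemma bounded_simple_pole (r : R) : 0 < r -> r != 1 -> bounded_seq (simple_pole r).
Proof.
move=> r0 r1; exists 1 => k; rewrite /simple_pole.
have h (x : R) n : 0 <= x <= 1 -> `|x ^+ n| <= 1.
  by move=> /andP[x0 x1]; rewrite ger0_norm ?exprn_ge0 // exprn_ile1.
case: ltgtP r1 => // hr _; case: ifP; rewrite ?normr0 ?ler01 //.
  by rewrite h // !ltW.
by rewrite normrN h // invr_ge0 invf_le1 // !ltW.
Qed.

Lemma act_unit_seq P (k : nat) : act P unit_seq k = P`_k.
Proof.
rewrite (@act_widen _ (maxn (size P) k.+1)) ?leq_maxl //.
have hk : (k < maxn (size P) k.+1)%N by rewrite leq_max ltnSn orbT.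
rewrite (bigD1 (Ordinal hk)) //= /unit_seq subrr eqxx mulr1 big1 ?addr0 // => i ik.
rewrite subr_eq0; case: eqP => [[e]|]; last by rewrite mulr0.
by case/eqP: ik; apply/val_inj.
Qed.

Lemma bounded_unit_seq : bounded_seq (@unit_seq R).
Proof. by exists 1 => k; rewrite /unit_seq; case: eqP; rewrite ?normr1 ?normr0. Qed.

(** Laurent expansion of [N / P] on the unit circle: poles below 1 feed the negative indices, poles
    above 1 the nonnegative ones. The last hypothesis makes the residues nonnegative below 1 and
    nonpositive above, so that both halves become moments of positive measures. *)
Lemma sturm_quotient n r P Q N : sturm_roots n r P Q ->
  0 < (-1) ^+ n * lead_coef P -> (size N <= n.*2.+1)%N ->
  0 <= (-1) ^+ n * N`_(n.*2) -> 0 <= (-1) ^+ n * N.[0] ->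
  (forall k, (k < n.*2)%N -> 0 <= (-1) ^+ (n + k + (k < n)) * N.[r k]) ->
  exists c : int -> R, [/\ bounded_seq c, forall k, 0 <= c k,
    completely_monotone (fun k : nat => c k),
    completely_monotone (fun k : nat => c (- k%:Z)) &
    act P c = act N unit_seq].
Proof.
move=> [r0 r1 rS PE _] hlead sN N2n N0 Nr.
set kappa := lead_coef P in PE hlead.
have kappa0 : kappa != 0.
  by apply: contraTneq hlead => ->; rewrite mulr0 ltxx.
have NE := partial_fractions kappa0 rS sN.
set kappa' := N`_(n.*2) / kappa in NE.
pose den k := kappa * \prod_(i < n.*2 | i != k :> nat) (r k - r i).
pose rho k := N.[r k] / den k.
pose cof k := \prod_(i < n.*2 | i != k :> nat) ('X - (r i)%:P).
rewrite -PE in NE.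
have {}NE : N = kappa' *: P + \sum_(k < n.*2) rho k *: (kappa *: cof k) by exact: NE.
have kappa'0 : 0 <= kappa'.
  have -> : kappa' = ((-1) ^+ n * N`_(n.*2)) / ((-1) ^+ n * kappa).
    by rewrite -mulf_div divff ?mul1r // signr_eq0.
  by rewrite divr_ge0 // ltW.
have rho_sign k : (k < n.*2)%N -> if (k < n)%N then 0 <= rho k else rho k <= 0.
  move=> kn; have h1 := sign_prod_diff kn rS.
  have {h1} : 0 < (-1) ^+ (n + k).+1 * den k.
    have := mulr_gt0 hlead h1; congr (0 < _); rewrite mulrACA; congr (_ * _).
    by rewrite -exprD; apply: sign_eq; lia.
  rewrite exprS mulN1r mulNr oppr_gt0 => h1.
  have := Nr k kn; rewrite /rho exprD.
  move: h1; case: (sign_cases (R := R) (n + k)) => ->; case: (k < n)%N;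
    rewrite ?expr0 ?expr1 ?mulr1 ?mul1r ?mulN1r ?opprK ?oppr_lt0 ?oppr_ge0 => h1 h2.
  - by rewrite mulr_le0 // invr_le0 ltW.
  - by rewrite mulr_ge0_le0 // invr_le0 ltW.
  - by rewrite mul1r in h2; rewrite mulr_ge0 // invr_ge0 ltW.
  - by rewrite mulr_le0_ge0 // invr_ge0 ltW.
have rneq k : (k < n.*2)%N -> r k != 1.
  by move=> /r1; case: ifP => _ h; [rewrite lt_eqF|rewrite gt_eqF].
(* [G0] is [N / P] at [w = 0], while [kappa'] is its value at infinity. The coefficient at index 0
   belongs to both halves: the right one writes it with the extra mass [kappa'], the left one with
   the extra mass [G0]. *)
pose G0 := kappa' - \sum_(k < n.*2) rho k / r k.
have G00 : 0 <= G0.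
  pose P0 := kappa * \prod_(k < n.*2) (0 - r k).
  have P0s : 0 < (-1) ^+ n * P0.
    have := sign_prod_XsubC (t := 0) (leq0n n.*2) _ r0 (r := r).
    move=> /(_ ltac:(by [])); rewrite addn0 => h.
    have := mulr_gt0 hlead h; congr (0 < _); rewrite mulrACA; congr (_ * _).
    by rewrite -exprD; apply: sign_eq; lia.
  have e : N.[0] = P0 * G0.
    rewrite NE hornerD hornerZ horner_sum mulrBr; congr (_ + _).
      rewrite PE hornerZ horner_prod mulrC; congr (_ * _ * _).
      by apply: eq_bigr => k _; rewrite hornerXsubC.
    rewrite mulr_sumr -sumrN; apply: eq_bigr => k _.
    rewrite !hornerZ horner_prod /P0 [in RHS](bigD1 k) //= sub0r.
    rewrite (eq_bigr (fun i : 'I_(n.*2) => 0 - r i)); last first.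
      by move=> i _; rewrite hornerXsubC.
    rewrite (eq_bigl (fun i : 'I_(n.*2) => i != k)); last by [].
    have : r k != 0 by rewrite gt_eqF // r0.
    move: (\prod_(_ < _ | _) _) (rho k) (r k) => x y z z0; by field.
  by move: N0; rewrite e mulrA pmulr_rge0.
pose c k := kappa' * unit_seq k + \sum_(i < n.*2) rho i * simple_pole (r i) k.
have right i : (i < n.*2)%N -> (n <= i)%N -> r i < 1 = false.
  move=> /r1; rewrite ltnNge => h h'; move: h; rewrite h' /= => h.
  by apply/negbTE; rewrite -leNgt ltW.
have left i : (i < n.*2)%N -> (i < n)%N -> r i < 1 by move=> h h'; have := r1 i h; rewrite h'.
have cpos (k : nat) : c k = kappa' * (k == 0%N)%:R +
    \sum_(i < n.*2) (if (i < n)%N then 0 else - rho i / r i) *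
      (if (i < n)%N then 0 else (r i)^-1) ^+ k.
  rewrite /c /unit_seq; congr (_ + _); apply: eq_bigr => i _.
  rewrite /simple_pole; case: ltnP => h; first by rewrite left // mul0r mulr0.
  by rewrite right // exprS mulrN mulrA !mulNr.
have cneg (k : nat) : c (- k%:Z) = G0 * (k == 0%N)%:R +
    \sum_(i < n.*2) (if (i < n)%N then rho i / r i else 0) *
      (if (i < n)%N then r i else 0) ^+ k.
  case: k => [|k].
    rewrite oppr0 cpos /G0 eqxx !mulr1 -addrA; congr (_ + _).
    rewrite -sumrN -big_split; apply: eq_bigr => i _ /=.
    by rewrite !expr0 !mulr1; case: ifP => _; rewrite ?addNr // addr0 mulNr.
  rewrite mulr0 add0r /c /unit_seq mulr0 add0r; apply: eq_bigr => i _.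
  rewrite /simple_pole; case: ltnP => h; last by rewrite right // mul0r mulr0.
  rewrite left //= -mulrA exprS mulKf // gt_eqF // r0 //.
have cm1 : completely_monotone (fun k : nat => c k).
  apply: (completely_monotone_ext cpos); apply: completely_monotoneD.
    exact: completely_monotone0.
  apply: (@completely_monotone_sum _ (fun i => if (i < n)%N then 0 else - rho i / r i)
    (fun i => if (i < n)%N then 0 else (r i)^-1)) => i i2n.
  have := rho_sign i i2n; have := r1 i i2n; have := r0 i i2n; case: ltnP => _ h1 h2 h3.
    by rewrite lexx ler01.
  rewrite mulr_ge0 ?oppr_ge0 ?invr_ge0 ?(ltW h1) // invf_le1 // ltW //.
have cm2 : completely_monotone (fun k : nat => c (- k%:Z)).
  apply: (completely_monotone_ext cneg); apply: completely_monotoneD.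
    exact: completely_monotone0.
  apply: (@completely_monotone_sum _ (fun i => if (i < n)%N then rho i / r i else 0)
    (fun i => if (i < n)%N then r i else 0)) => i i2n.
  have := rho_sign i i2n; have := r1 i i2n; have := r0 i i2n; case: ltnP => _ h1 h2 h3.
    by rewrite mulr_ge0 ?invr_ge0 ?(ltW h1) ?(ltW h2).
  by rewrite lexx ler01.
exists c; split=> //.
- apply: bounded_seqD; first exact: bounded_seqZ bounded_unit_seq.
  apply: (@bounded_seq_sum _ _ (fun (j : 'I_(n.*2)) k => rho j * simple_pole (r j) k)) => j.
  by apply/bounded_seqZ/bounded_simple_pole; [apply: r0|apply: rneq].
- case=> k; first by have := cm1 0%N k; rewrite expr0 mul1r.
  by have := cm2 0%N k.+1; rewrite expr0 mul1r NegzE.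
apply/funext => k; rewrite /c actDr actZr.
rewrite (@act_sumr _ _ _ (fun (j : 'I_(n.*2)) k => rho j * simple_pole (r j) k)).
rewrite NE actD actZ act_sum; congr (_ + _); apply: eq_bigr => i _.
rewrite actZr actZ; congr (_ * _).
have {1}-> : P = (kappa *: cof i) * ('X - (r i)%:P).
  by rewrite {1}PE (bigD1 i) //= -scalerAl mulrC.
by rewrite actM act_simple_pole ?r0 ?rneq.
Qed.

End PartialFractions.

(** * Solving the recurrences within bounded sequences *)

Section LinkSolve.
Context {R : realType}.
Implicit Types (p : R) (a b : int -> R).

Definition nonneg_bounded a := (forall k, 0 <= a k) /\ bounded_seq a.

Lemma nonneg_bounded_reflection a : nonneg_bounded a -> nonneg_bounded (reflection a).
Proof.
move=> [a0 [C hC]]; split=> [k|]; first exact: a0.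
by exists C => k; apply: hC.
Qed.

Lemma link_Geo_solve p a : 0 <= p < 1 -> nonneg_bounded a ->
  exists b, nonneg_bounded b /\ link Geo p a b.
Proof.
move=> /andP[p0 p1] [a0 [C hC]].
have C0 : 0 <= C by apply: le_trans (hC 0).
pose u k n := \sum_(i < n) p ^+ i * a (k - i%:Z).
have u0 k n : 0 <= u k n by apply: sumr_ge0 => i _; rewrite mulr_ge0 ?exprn_ge0.
have uC k n : u k n <= C / (1 - p).
  apply: (@le_trans _ _ (C * \sum_(i < n) p ^+ i)).
    rewrite mulr_sumr; apply: ler_sum => i _; rewrite mulrC.
    by apply: ler_wpM2r; [apply: exprn_ge0|apply: le_trans (ler_norm _) (hC _)].
  by apply: ler_wpM2l => //; apply: sum_geometric_le; rewrite p0 p1.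
have cu k : cvgn (u k).
  apply: nondecreasing_is_cvgn.
    apply/nondecreasing_seqP => n; rewrite /u big_ord_recr /= lerDl.
    by rewrite mulr_ge0 ?exprn_ge0.
  by exists (C / (1 - p)) => _ [n _ <-].
exists (fun k => limn (u k)); split.
  have l0 k : 0 <= limn (u k) by apply: limr_ge => //; apply: nearW.
  split=> //; exists (C / (1 - p)) => k; rewrite ger0_norm //.
  by apply: limr_le => //; apply: nearW.
move=> k; apply: cvg_lim => //.
rewrite -(cvg_shiftS (u k)).
have -> : [sequence u k n.+1]_n = (fun n => a k + p * u (k - 1) n).
  apply/funext => n; rewrite /= /u big_ord_recl expr0 mul1r subr0; congr (_ + _).
  rewrite mulr_sumr; apply: eq_bigr => i _.
  by rewrite exprS -mulrA; congr (_ * (_ * a _)); rewrite /= /bump; lia.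
by apply: cvgD; [apply: cvg_cst|apply: cvgMr; apply: cu].
Qed.

Lemma link_RGeo_solve p a : 0 <= p < 1 -> nonneg_bounded a ->
  exists b, nonneg_bounded b /\ link RGeo p a b.
Proof.
move=> hp ha.
have [b [hb hl]] := link_Geo_solve hp (nonneg_bounded_reflection ha).
exists (reflection b); split; first exact: nonneg_bounded_reflection.
move=> k; have := hl (- k); rewrite /reflection opprK => ->.
by have -> : - k - 1 = - (k + 1) by lia.
Qed.

(** Each factor [f0 w + f1] is [(f0 + f1) w (p + (1 - p) / w)] with [p = f0 / (f0 + f1)], a multiple
    of [w] times the generating function of a reflected two-point sequence. *)
Lemma decomposable_TP n (f0 f1 : nat -> R) ts a :
  (forall i, (i < n)%N -> 0 < f0 i /\ 0 < f1 i) ->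
  nonneg_bounded a -> decomposable ts a -> exists b, [/\ nonneg_bounded b,
    decomposable (nseq n TP ++ ts) b &
    act ('X^n * (\prod_(i < n) (f0 i + f1 i))%:P) b =
    act (\prod_(i < n) (f0 i *: 'X + (f1 i)%:P)) a].
Proof.
elim: n => [|n IH] hf ha da.
  by exists a; split=> //; rewrite !big_ord0 mul1r.
have [b [[b0 [C hC]] db hb]] := IH (fun i h => hf i (ltnW h)) ha da.
have [f00 f10] := hf n (ltnSn n).
pose s := f0 n + f1 n; have s0 : 0 < s by rewrite addr_gt0.
pose p := f0 n / s.
have p0 : 0 <= p by rewrite divr_ge0 ?ltW.
have p1 : p <= 1 by rewrite ler_pdivrMr // mul1r lerDl ltW.
have q0 : 0 <= 1 - p by rewrite subr_ge0.
pose b' k := p * b k + (1 - p) * b (k + 1).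
exists b'; split.
- have b'0 k : 0 <= b' k by apply: addr_ge0; apply: mulr_ge0.
  split=> //; exists (C + C) => k; rewrite ger0_norm //.
  have h1 i : b i <= C by apply: le_trans (ler_norm _) (hC _).
  apply: lerD; [apply: le_trans (h1 k)|apply: le_trans (h1 (k + 1))];
    by apply: ler_piMl => //; lra.
- exists p, b; split=> //; by rewrite p0 p1.
- have e : act ('X * s%:P) b' = act (f0 n *: 'X + (f1 n)%:P) b.
    apply/funext => k; rewrite mulrC act_mulX actC actD actZ actX actC /b' subrK.
    have -> : 1 - p = f1 n / s by rewrite /p /s; field; rewrite gt_eqF.
    by rewrite /p; field; rewrite gt_eqF.
  rewrite !big_ord_recr /= -/s polyCM.
  have -> : 'X^(n.+1) * ((\prod_(i < n) (f0 i + f1 i))%:P * s%:P) =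
    ('X^n * (\prod_(i < n) (f0 i + f1 i))%:P) * ('X * s%:P) by rewrite exprSr; ring.
  by rewrite actM e -actM mulrC actM hb -actM mulrC.
Qed.

(** For [s < 1], [w / (w - s) = 1 / (1 - s / w)] is a reflected geometric series. *)
Lemma decomposable_RGeo n (s : nat -> R) ts a :
  (forall i, (i < n)%N -> 0 < s i < 1) ->
  nonneg_bounded a -> decomposable ts a -> exists b, [/\ nonneg_bounded b,
    decomposable (nseq n RGeo ++ ts) b &
    act (\prod_(i < n) ('X - (s i)%:P)) b = act 'X^n a].
Proof.
elim: n => [|n IH] hs ha da.
  by exists a; split=> //; rewrite big_ord0.
have [b [hb db eb]] := IH (fun i h => hs i (ltnW h)) ha da.
have /andP[s0 s1] := hs n (ltnSn n).
have [|b' [hb' hl]] := @link_RGeo_solve (s n) b _ hb; first by rewrite ltW.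
exists b'; split=> //.
  by exists (s n), b; split=> //; rewrite ?ltW //; case: hb.
have e : act ('X - (s n)%:P) b' = act 'X b.
  apply/funext => k; rewrite act_XsubC actX (hl (k - 1)) subrK.
  by rewrite addrK.
by rewrite big_ord_recr /= actM e -actM mulrC actM eb -actM -exprS.
Qed.

(** For [s > 1], [- s / (w - s) = 1 / (1 - w / s)] is a geometric series of ratio [s^-1]. *)
Lemma decomposable_Geo n (s : nat -> R) ts a : (forall i, (i < n)%N -> 1 < s i) ->
  nonneg_bounded a -> decomposable ts a -> exists b, [/\ nonneg_bounded b,
    decomposable (nseq n Geo ++ ts) b &
    act (\prod_(i < n) ('X - (s i)%:P)) b = act ((\prod_(i < n) - s i)%:P) a].
Proof.
elim: n => [|n IH] hs ha da.
  by exists a; split=> //; rewrite !big_ord0.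
have [b [hb db eb]] := IH (fun i h => hs i (ltnW h)) ha da.
have s1 := hs n (ltnSn n); have s0 : 0 < s n by apply: lt_trans s1.
have hp : 0 <= (s n)^-1 < 1 by rewrite invr_ge0 ltW //= invf_lt1.
have [b' [hb' hl]] := link_Geo_solve hp hb.
exists b'; split=> //.
  have /andP[p0 p1] := hp.
  by exists (s n)^-1, b; split=> //; rewrite ?p0 ?ltW //; case: hb.
have e : act ('X - (s n)%:P) b' = act (- s n)%:P b.
  apply/funext => k; rewrite act_XsubC actC (hl k) mulrDr mulrA divff ?gt_eqF //.
  by rewrite mul1r; ring.
by rewrite !big_ord_recr /= actM e -actM mulrC actM eb -actM polyCM mulrC.
Qed.

End LinkSolve.

(** * First passage in a finite chain of levels *)

Section Chain.
Context {R : realType} (F0 F1 B0 B1 : nat -> R).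
Hypothesis F0_gt0 : forall i, 0 < F0 i.
Hypothesis F1_gt0 : forall i, 0 < F1 i.
Hypothesis B0_gt0 : forall i, 0 < B0 i.
Hypothesis B1_gt0 : forall i, 0 < B1 i.
Hypothesis sum_le1 : forall i, F0 i + F1 i + B0 i + B1 i <= 1.

(** The levels are numbered from the truncated end towards the target. [fwd] is the forward weight
    [F0 + F1 / w] multiplied by [w], so a step forward and back weighs [coupling / w]. *)
Definition fwd i : {poly R} := F0 i *: 'X + (F1 i)%:P.
Definition bwd i : {poly R} := B1 i *: 'X + (B0 i)%:P.
Definition coupling (s i : nat) : {poly R} := bwd (s + i).+1 * fwd (s + i).

Definition chainS s j : {poly R} := sturm (coupling s) j.

(* ['X^j] times the determinant of [1 - J], where [J] is the generating matrix of
   one step between the [j] levels [s], ..., [s + j - 1]; [chainS s j] is the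
   same determinant times ['X^(j./2)]. *)
Definition chainQ s j : {poly R} := continuant 'X (fun i => 'X * coupling s i) j.

Lemma linear_eval (a b w : R) : (a *: 'X + b%:P).[w] = a * w + b.
Proof. by rewrite !hornerE. Qed.

Lemma size_linear (a b : R) : (size (a *: 'X + b%:P)%R <= 2)%N.
Proof.
apply: leq_trans (size_polyD _ _) _; rewrite geq_max; apply/andP; split.
  by apply: leq_trans (size_scale_leq _ _) _; rewrite size_polyX.
by apply: leq_trans (size_polyC_leq1 _) _.
Qed.

Lemma size_coupling s i : (size (coupling s i) <= 3)%N.
Proof.
apply: leq_trans (size_polyMleq _ _) _.
have := size_linear (B1 (s + i).+1) (B0 (s + i).+1).
have := size_linear (F0 (s + i)) (F1 (s + i)).
rewrite /bwd /fwd; move: (size _) (size _) => u v; lia.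
Qed.

Lemma lead_coupling s i : 0 < (coupling s i)`_2.
Proof.
rewrite -[2%N]/(1 + 1)%N coef_mul_top ?size_linear //.
by rewrite !coefD !coefZ !coefX !coefC /= !mulr1 !addr0 mulr_gt0.
Qed.

Lemma coupling_gt0 s i (w : R) : 0 <= w -> 0 < (coupling s i).[w].
Proof.
move=> w0; rewrite hornerM !linear_eval.
by rewrite mulr_gt0 // ltr_wpDl // mulr_ge0 // ltW.
Qed.

(** The induction carries the stronger claim that [(F0 + F1) * chainS s j / chainS s j.+1] at 1, the
    mass that ever leaves forward from level [s + j] without going behind [s], is below 1. It starts
    from the backward mass lost at level [s]. *)
Lemma chain_1 s j : 0 < (chainS s j).[1].
Proof.
suff : 0 < (chainS s j).[1] /\
    (F0 (s + j) + F1 (s + j)) * (chainS s j).[1] < (chainS s j.+1).[1] by case.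
have lt1 i : F0 i + F1 i < 1.
  by apply: lt_le_trans (sum_le1 i); rewrite -addrA ltrDl addr_gt0.
elim: j => [|j [IH1 IH2]].
  by rewrite addn0 !hornerC ltr01 mulr1.
have F0' : 0 < F0 (s + j) + F1 (s + j) by rewrite addr_gt0.
have h1 : 0 < (chainS s j.+1).[1] by apply: lt_trans IH2; apply: mulr_gt0.
split=> //.
rewrite [in ltRHS]/chainS sturmSS hornerD hornerN !hornerM hornerXn expr1n mul1r.
rewrite !linear_eval !mulr1 -!/(chainS _ _) addnS.
have hb : 0 < B1 (s + j).+1 + B0 (s + j).+1 by rewrite addr_gt0.
have := ler_wpM2r (ltW h1) (sum_le1 (s + j).+1).
have : (B1 (s + j).+1 + B0 (s + j).+1) * ((F0 (s + j) + F1 (s + j)) * (chainS s j).[1]) <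
  (B1 (s + j).+1 + B0 (s + j).+1) * (chainS s j.+1).[1] by rewrite ltr_pM2l.
rewrite -mulrA; move: (_ * (_ * (chainS s j).[1])) => u; nra.
Qed.

Lemma chain_roots s j : exists r p, sturm_roots (j./2) r (chainS s j) p.
Proof.
case: j => [|j].
  exists (fun=> 0), 1; split=> //; first by move=> i j /andP[_].
  by rewrite big_ord0 -[chainS s 0]/(1 : {poly R}) lead_coef1 scale1r.
have [r hr] := sturm_rootsP (@size_coupling s) (@lead_coupling s)
  (@coupling_gt0 s) (@chain_1 s) j.
by exists r, (chainS s j).
Qed.

Lemma chain_lead s j : 0 < (-1) ^+ (j./2) * lead_coef (chainS s j).
Proof. exact: (lead_coef_sturm (@size_coupling s) (@lead_coupling s)). Qed.

Lemma chainQE s j : chainQ s j = 'X^(uphalf j) * chainS s j.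
Proof. exact: continuant_sturm. Qed.

Lemma injective_chainQ s j : injective_act (chainQ s j).
Proof.
rewrite chainQE; apply: injective_actM; first exact: injective_actXn.
have [r [p [r0 r1 _ -> _]]] := chain_roots s j.
apply: injective_actZ.
  by apply: contraTneq (chain_lead s j) => ->; rewrite mulr0 ltxx.
apply: (@injective_act_prod _ _ r predT) => i hi; split; first exact: r0.
by have := r1 i hi; case: ifP => _ h; [rewrite lt_eqF|rewrite gt_eqF].
Qed.

(** At a root of the full determinant Euler's identity turns the product of the last two factors
    into a positive multiple of the first one, which leaves a square. *)
Lemma chain_green_sign m l r p k : sturm_roots ((m + l).+1./2) r (chainS 0 (m + l).+1) p ->
  (k < ((m + l).+1./2).*2)%N ->
  0 <= (chainS 0 m).[r k] * (chainS m.+1 l).[r k] * (chainS 0 (m + l)).[r k].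
Proof.
move=> [r0 _ _ PE _] hk.
have rk0 := r0 k hk.
have root : (chainS 0 (m + l).+1).[r k] = 0.
  rewrite PE hornerZ horner_prod (bigD1 (Ordinal hk)) //= hornerXsubC subrr mul0r.
  by rewrite mulr0.
have QS s j : (chainQ s j).[r k] = r k ^+ (uphalf j) * (chainS s j).[r k].
  by rewrite chainQE hornerM hornerXn.
have [l0|[l' l0]] : l = 0%N \/ exists l', l = l'.+1.
- by case: (l) => [|l']; [left|right; exists l'].
- by subst l; rewrite addn0 [chainS _ 0]/chainS hornerC mulr1 -expr2 sqr_ge0.
subst l; rename l' into l.
have e := continuant_euler 'X (fun i => 'X * coupling 0 i) m l.
have {}e := congr1 (fun p => p.[r k]) e.
have c1 : continuant 'X (fun i => 'X * coupling 0 (m.+1 + i)) l.+1 = chainQ m.+1 l.+1.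
  by [].
rewrite c1 hornerD hornerN !hornerM -!/(chainQ 0 _) in e.
rewrite addnS in root *.
have pos : 0 < (\prod_(i < l.+1) ('X * coupling 0 (m + i))).[r k].
  rewrite horner_prod; apply: prodr_gt0 => i _.
  by rewrite hornerM hornerX mulr_gt0 // coupling_gt0 // ltW.
move: e; rewrite !QS root mulr0 mul0r subr0 => e.
have rk i : 0 < r k ^+ i by rewrite exprn_gt0.
rewrite -(pmulr_rge0 _ (rk (uphalf m))) -(pmulr_rge0 _ (rk (uphalf l.+1))).
rewrite -(pmulr_rge0 _ (rk (uphalf (m + l).+1))).
have -> : r k ^+ uphalf (m + l).+1 * (r k ^+ uphalf l.+1 * (r k ^+ uphalf m *
   ((chainS 0 m).[r k] * (chainS m.+1 l.+1).[r k] * (chainS 0 (m + l).+1).[r k]))) =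
   (r k ^+ uphalf m * (chainS 0 m).[r k]) *
   (r k ^+ uphalf l.+1 * (chainS m.+1 l.+1).[r k] *
   (r k ^+ uphalf (m + l).+1 * (chainS 0 (m + l).+1).[r k])) by ring.
by rewrite e mulrCA -expr2 mulr_ge0 ?sqr_ge0 // ltW.
Qed.

Lemma chain_green m l : exists c : int -> R, [/\ bounded_seq c, AM_CM c &
  act (chainQ 0 (m + l).+1) c =
  act ('X * chainQ 0 m * chainQ m.+1 l) unit_seq].
Proof.
have [r hr] := sturm_rootsP (@size_coupling 0) (@lead_coupling 0)
  (@coupling_gt0 0) (@chain_1 0) (m + l).
have hsign := fun k => @chain_green_sign m l r _ k hr.
have [r0 _ _ _ rq] := hr.
(* [d] is 0 if [m] and [l] are both even and 1 otherwise; ['X^d] makes up for the different powers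
   of ['X] in the normalization of [chainS]. For [d = 1] the numerator has zero top coefficient and
   vanishes at 0, so both sign conditions are trivial. *)
pose d := ((m + l).+1./2 - m./2 - l./2)%N.
have [hd d1] : ((m + l).+1./2 = m./2 + l./2 + d)%N /\ (d <= 1)%N.
  rewrite /d half_succ halfD; have := odd_double_half m; have := odd_double_half l.
  by rewrite oddD; case: (odd m); case: (odd l) => /=; lia.
pose N : {poly R} := 'X^d * (chainS 0 m * chainS m.+1 l).
have sz s j : (size (chainS s j) <= (j./2).*2.+1)%N.
  exact: (size_sturm (@size_coupling s)).
have ld s j := lead_sturm (@size_coupling s) (@lead_coupling s) j.
have z s j := sturm_0 (@coupling_gt0 s) j.
have szp : (size (chainS 0 m * chainS m.+1 l)%R <= (m./2).*2 + (l./2).*2 + 1)%N.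
  apply: leq_trans (size_polyMleq _ _) _; have := sz 0%N m; have := sz m.+1 l.
  move: (size _) (size _) => u v; lia.
have sN : (size N <= ((m + l).+1./2).*2.+1)%N.
  apply: leq_trans (size_polyMleq _ _) _; rewrite size_polyXn.
  move: szp; rewrite hd; move: (size _) => u; lia.
have N2n : 0 <= (-1) ^+ ((m + l).+1./2) * N`_(((m + l).+1./2).*2).
  move: d1; rewrite leq_eqVlt ltnS leqn0 => /orP[] /eqP d01.
    rewrite /N d01 expr1 coefXM; case: ifP => _; first by rewrite mulr0.
    rewrite nth_default ?mulr0 //; apply: leq_trans szp _; rewrite hd; lia.
  rewrite /N hd d01 expr0 mul1r addn0 doubleD coef_mul_top //.
  by rewrite exprD mulrACA mulr_ge0 // ltW // ld.
have N0 : 0 <= (-1) ^+ ((m + l).+1./2) * N.[0].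
  move: d1; rewrite leq_eqVlt ltnS leqn0 => /orP[] /eqP d01.
    by rewrite /N d01 expr1 hornerM hornerX mul0r mulr0.
  rewrite /N hd d01 expr0 mul1r addn0 hornerM exprD mulrACA.
  by rewrite mulr_ge0 // ltW // z.
have Nr k : (k < ((m + l).+1./2).*2)%N ->
    0 <= (-1) ^+ ((m + l).+1./2 + k + (k < (m + l).+1./2)) * N.[r k].
  move=> hk; have := hsign k hk; have := rq k hk; rewrite -/(chainS 0 (m + l)).
  rewrite /N !hornerM hornerXn mulrCA => h1 h2.
  apply: mulr_ge0; first by rewrite exprn_ge0 // ltW // r0.
  move: h1 h2; case: (sign_cases (R := R) ((m + l).+1./2 + k + (k < (m + l).+1./2))) => ->;
    rewrite ?mul1r ?mulN1r => h1.
    by rewrite pmulr_lge0.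
  by rewrite oppr_gt0 in h1; rewrite nmulr_lge0 // oppr_ge0.
have [c [bc c0 cm1 cm2 ec]] := sturm_quotient hr (chain_lead 0 _) sN N2n N0 Nr.
exists c; split=> //.
- split=> //; split=> //; apply: contrapT => /forallNP cz.
  have cz' x : c x = 0 by apply/eqP/negPn/negP; apply: cz.
  have N1 : N.[1] != 0.
    rewrite /N !hornerM hornerXn expr1n mul1r gt_eqF // mulr_gt0 //; exact: chain_1.
  case/eqP: N1; suff -> : N = 0 by rewrite horner0.
  apply/polyP => k; rewrite coef0 -act_unit_seq -ec /act big1 // => i _.
  by rewrite cz' mulr0.
- rewrite chainQE actM ec -actM !chainQE; congr act.
  rewrite /N mulrA -exprD; have -> : (uphalf (m + l).+1 + d = (uphalf m + uphalf l).+1)%N.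
    rewrite !uphalf_half; have := odd_double_half (m + l).+1.
    have := odd_double_half m; have := odd_double_half l.
    move: hd; rewrite /= oddD; case: (odd m); case: (odd l) => /=; lia.
  by rewrite exprS exprD; ring.
Qed.

Section Passage.
Context (L : nat) (h : nat -> int -> R).
Hypothesis h_bounded : forall i, bounded_seq (h i).
Hypothesis h_rec : forall i k, (i < L)%N -> h i k =
  F0 i * h i.+1 k + F1 i * h i.+1 (k + 1) +
  (if i is i'.+1 then B0 i * h i' k + B1 i * h i' (k - 1) else 0).

Lemma act_fwd i a k : act (fwd i) a k = F0 i * a (k - 1) + F1 i * a k.
Proof. by rewrite actD actZ actX actC. Qed.

(** Gaussian elimination of the levels behind [i]: in generating functions, one step forward costs
    [fwd i] times a quotient of consecutive determinants. *)
Lemma passage_step i : (i < L)%N ->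
  act (chainQ 0 i.+1) (h i) = act (fwd i * chainQ 0 i) (h i.+1).
Proof.
elim: i => [|i IH] iL; apply/funext => k.
  rewrite [chainQ 0 1]/chainQ [chainQ 0 0]/chainQ /= mulr1 actX act_fwd h_rec //.
  by rewrite addr0 subrK.
have e : act 'X (h i.+1) = (fun k => act (fwd i.+1) (h i.+2) k +
    act ('X * bwd i.+1) (h i) k).
  apply/funext => j; rewrite actX act_fwd h_rec // subrK actM actX actD actZ actX actC.
  by rewrite [B0 _ * _ + _]addrC.
rewrite [chainQ 0 i.+2]/chainQ continuantSS -!/(chainQ 0 _) -mulNr actD.
have -> : 'X * chainQ 0 i.+1 = chainQ 0 i.+1 * 'X by rewrite mulrC.
rewrite [act (_ * 'X) _]actM e actDr -!actM.
have -> : chainQ 0 i.+1 * ('X * bwd i.+1) = ('X * bwd i.+1) * chainQ 0 i.+1.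
  by rewrite mulrC.
rewrite [act (_ * chainQ 0 i.+1) (h i)]actM IH ?(ltnW iL) // -actM.
rewrite /coupling add0n.
have -> : - ('X * (bwd i.+1 * fwd i)) * chainQ 0 i =
  (-1) *: ('X * bwd i.+1 * (fwd i * chainQ 0 i)) by rewrite scaleN1r; ring.
by rewrite actZ mulN1r addrK mulrC.
Qed.

(** The quotients telescope; the intermediate determinants are cancelled by injectivity on bounded
    sequences. *)
Lemma passage_prod m d : (m + d <= L)%N ->
  act (chainQ 0 (m + d)) (h m) =
  act ((\prod_(i < d) fwd (m + i)) * chainQ 0 m) (h (m + d)).
Proof.
elim: d => [|d IH] mdL; first by rewrite addn0 big_ord0 mul1r.
have mdL' : (m + d < L)%N by lia.
apply/funext; apply: (injective_act_eq (@injective_chainQ 0 (m + d))).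
- exact/bounded_act/h_bounded.
- exact/bounded_act/h_bounded.
move=> k; rewrite -!actM [in LHS]mulrC [in LHS]actM IH ?(ltnW mdL') //.
rewrite -[in LHS]actM [in LHS]mulrC [in LHS]actM addnS passage_step //.
rewrite -[in LHS]actM big_ord_recr /=.
by congr (act _ _ k); ring.
Qed.

End Passage.

(** A sequence [b] is built from the Green function by solving one recurrence per factor. It equals
    [h m] because both are bounded and satisfy the same equation after clearing denominators. *)
Lemma chain_decomposable m l (h : nat -> int -> R) :
  (forall i, bounded_seq (h i)) -> h (m + l).+1 = unit_seq ->
  (forall i k, (i < (m + l).+1)%N -> h i k =
    F0 i * h i.+1 k + F1 i * h i.+1 (k + 1) +
    (if i is i'.+1 then B0 i * h i' k + B1 i * h i' (k - 1) else 0)) ->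
  decomposable (nseq l./2 Geo ++ nseq l./2 RGeo ++ nseq l.+1 TP) (h m).
Proof.
move=> hb hL hrec.
have [c [bc [[c0 cn0] cm1 cm2] ec]] := chain_green m l.
have eh := @passage_prod _ h hb hrec m l.+1 ltac:(lia).
rewrite !addnS hL in eh.
have [r [p [r0 r1 _ PE _]]] := chain_roots m.+1 l.
have hlead := chain_lead m.+1 l.
set n := l./2 in r0 r1 PE hlead *.
set lam := lead_coef _ in PE hlead.
pose s i := r (n + i)%N.
have sl i : (i < n)%N -> 0 < r i < 1.
  by move=> i_n; have := r1 i ltac:(lia); rewrite i_n r0 //; lia.
have sr i : (i < n)%N -> 1 < s i.
  by move=> i_n; have := r1 (n + i)%N ltac:(lia); rewrite ifF //; lia.
pose kr : R := \prod_(i < n) - s i.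
pose kT : R := \prod_(i < l.+1) (F0 (m + i) + F1 (m + i)).
have kT0 : 0 < kT by apply: prodr_gt0 => i _; rewrite addr_gt0.
(* The sign [(-1) ^+ n] of the leading coefficient cancels that of the product of the [- s i]. *)
have lk : 0 < lam * kr.
  have -> : kr = (-1) ^+ n * \prod_(i < n) s i.
    by rewrite /kr prodrN cardE size_enum_ord.
  rewrite mulrA [lam * _]mulrC mulr_gt0 //; apply: prodr_gt0 => i _.
  exact: lt_trans (sr i (ltn_ord i)).
(* The constant left over once forward weights are normalized to mass 1 and linear factors to
   geometric series; the AM-CM sequence absorbs it. *)
pose mu : R := kT / (lam * kr).
have mu0 : 0 < mu by rewrite divr_gt0.
have bmc : bounded_seq (fun k => mu * c k) by apply: bounded_seqZ.
have nmc : nonneg_bounded (fun k => mu * c k).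
  by split=> // k; rewrite mulr_ge0 // ltW.
have cmZ d : completely_monotone d -> completely_monotone (fun k => mu * d k).
  move=> hd i k.
  have -> : iter i diffn (fun k => mu * d k) k = mu * iter i diffn d k.
    by elim: i k => //= i IH k; rewrite /diffn !IH mulrBr.
  by rewrite mulrCA mulr_ge0 // ltW.
have dmc : decomposable [::] (fun k => mu * c k).
  split; [split|exact: cmZ|exact: cmZ]; first by case: nmc.
  by have [k ck] := cn0; exists k; rewrite mulf_neq0 // gt_eqF.
have [bT [nT dT eT]] := @decomposable_TP _ l.+1 (fun i => F0 (m + i)%N)
  (fun i => F1 (m + i)%N) [::] _ ltac:(by []) nmc dmc.
have [bR [nR dR eR]] := decomposable_RGeo sl nT dT.
have [b [nb db eb]] := decomposable_Geo sr nR dR.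
rewrite cats0 in db.
suff -> : h m = b by [].
apply/funext.
pose D : {poly R} := 'X^(l.+1) * chainQ m.+1 l * kT%:P.
have D_inj : injective_act (chainQ 0 (m + l).+1 * D).
  apply: injective_actM (@injective_chainQ _ _) _.
  apply: injective_actM; last by apply: injective_actC; rewrite gt_eqF.
  exact: injective_actM (@injective_actXn _ _) (@injective_chainQ _ _).
apply: (injective_act_eq D_inj); [exact: hb|by case: nb|].
move=> k.
pose W : {poly R} := \prod_(i < l.+1) fwd (m + i).
have eT' : act ('X^(l.+1) * kT%:P) bT = act (W * mu%:P) c.
  rewrite eT actM; congr (act _ _); apply/funext => j.
  by rewrite actC.
have Qb : act D b = act (W * ('X^l * kT%:P)) c.
  have -> : D = ('X^(l.+1) * kT%:P * ('X^(uphalf l) * lam%:P)) *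
      (\prod_(i < n) ('X - (r i)%:P) * \prod_(i < n) ('X - (s i)%:P)).
    rewrite /D chainQE PE.
    have -> : \prod_(k0 < n.*2) ('X - (r k0)%:P) =
        \prod_(i < n) ('X - (r i)%:P) * \prod_(i < n) ('X - (s i)%:P).
      by rewrite -addnn big_split_ord.
    by rewrite -mul_polyC; ring.
  have eL : act (\prod_(i < n) ('X - (r i)%:P) * \prod_(i < n) ('X - (s i)%:P)) b =
      act (kr%:P * 'X^n) bT.
    by rewrite [in LHS]actM eb -[in LHS]actM [in LHS]mulrC [in LHS]actM eR -[in LHS]actM.
  rewrite actM eL -actM.
  have -> : 'X^(l.+1) * kT%:P * ('X^(uphalf l) * lam%:P) * (kr%:P * 'X^n) =
    ('X^l * (lam * kr)%:P) * ('X^(l.+1) * kT%:P).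
    have -> : 'X^l = 'X^(uphalf l) * 'X^n :> {poly R}.
      rewrite -exprD uphalf_half; congr ('X^_); have := odd_double_half l.
      by rewrite -addnn /n; lia.
    by rewrite polyCM; ring.
  rewrite actM eT' -actM.
  have -> : kT%:P = (lam * kr)%:P * mu%:P :> {poly R}.
    by rewrite -polyCM /mu mulrC divfK // gt_eqF.
  by congr act; ring.
rewrite [in RHS]actM Qb -[in RHS]actM [in RHS]mulrC [in RHS]actM ec -[in RHS]actM.
rewrite [in LHS]mulrC [in LHS]actM eh -[in LHS]actM.
by congr (act _ _ k); rewrite /D exprS -/W; ring.
Qed.

End Chain.

(** * Damping, truncation and perturbation *)

Section Tannery.
Context {R : realType}.
Implicit Types (u v : nat -> R).

Lemma dominated_series u v : (forall n, 0 <= u n <= v n) -> cvgn (series v) ->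
  cvgn (series u) /\ forall n0, 0 <= limn (series u) - series u n0 <=
    limn (series v) - series v n0.
Proof.
move=> uv cv.
have u0 n : 0 <= u n by have /andP[] := uv n.
have v0 n : 0 <= v n by have /andP[h1 h2] := uv n; apply: le_trans h2.
have mono x : (forall n, 0 <= x n) -> nondecreasing_seq (series x : nat -> R).
  move=> x0; apply/nondecreasing_seqP => n.
  by rewrite /series /= big_nat_recr //= lerDl.
have vle n : series v n <= limn (series v) by apply: nondecreasing_cvgn_le => //; apply: mono.
have diff n n0 : (n0 <= n)%N -> series u n - series u n0 <= series v n - series v n0.
  move=> h; rewrite !sub_series_geq //; apply: ler_sum => i _.
  by have /andP[] := uv i.
have cu : cvgn (series u).
  apply: nondecreasing_is_cvgn; first exact: mono.
  exists (limn (series v)) => _ [n _ <-].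
  have := @diff n 0%N isT; rewrite ![series _ 0%N]/series /= !big_geq // !subr0 => h.
  exact: le_trans h (vle n).
split=> // n0; rewrite subr_ge0 nondecreasing_cvgn_le //=; last exact: mono.
rewrite lerBlDr; apply: limr_le => //; exists n0 => // n /= hn.
by rewrite -lerBlDr; apply: le_trans (diff _ _ hn) _; rewrite lerD2r.
Qed.

Lemma tannery (u : nat -> nat -> R) v ul : (forall m n, 0 <= u m n <= v n) ->
  cvgn (series v) -> (forall n, u^~ n @ \oo --> ul n) ->
  (fun m => limn (series (u m))) @ \oo --> limn (series ul).
Proof.
move=> uv cv cu.
have ulv n : 0 <= ul n <= v n.
  rewrite -(cvg_lim _ (cu n)) //; have c := cvgP _ (cu n).
  apply/andP; split.
    by apply: limr_ge => //; apply: nearW => m; have /andP[] := uv m n.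
  by apply: limr_le => //; apply: nearW => m; have /andP[] := uv m n.
have [cul hul] := dominated_series ulv cv.
have hu m := dominated_series (uv m) cv.
apply/cvgrPdist_lt => e e0.
have e3 : 0 < e / 3 by rewrite divr_gt0.
have [n0 hn0] : exists n0, limn (series v) - series v n0 < e / 3.
  have /cvgrPdist_lt/(_ _ e3)[n0 _ h] := cv.
  exists n0; exact: le_lt_trans (ler_norm _) (h n0 (leqnn _)).
have : (fun m => series (u m) n0) @ \oo --> series ul n0.
  elim: (n0) => [|i IH].
    rewrite /series /= big_geq //.
    rewrite (_ : (fun m => _) = cst 0); first exact: cvg_cst.
    by apply/funext => m; rewrite big_geq.
  rewrite /series /= big_nat_recr //=.
  rewrite (_ : (fun m => _) = (fun m => series (u m) i + u m i)).
    by apply: cvgD => //; apply: cu.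
  by apply/funext => m; rewrite big_nat_recr.
move=> /cvgrPdist_lt/(_ _ e3); apply: filterS => m.
have /andP[a1 a2] := hul n0; have /andP[b1 b2] := (hu m).2 n0.
rewrite !ltr_norml => /andP[h1 h2]; apply/andP; split; lra.
Qed.

End Tannery.

Section Limits.
Context {R : realType}.

Lemma decomposable_cvgn ts (C : R) (fm : nat -> int -> R) f :
  (forall m k, 0 <= fm m k <= C) -> (forall m, decomposable ts (fm m)) ->
  (forall k, fm^~ k @ \oo --> f k) -> vanishing f -> (exists k, f k != 0) ->
  decomposable ts f.
Proof.
move=> bf df cf vf nf.
have [U [UU sU]] := @ultraFilterLemma nat \oo _.
apply: (@decomposable_cvg R U UU ts C fm f) => // k V /cf; exact: sU.
Qed.

End Limits.

(** * Expansion of the first passage over path lengths *)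

Variant step := Toward0 | Toward1 | Away0 | Away1.

Section Hitting.
Context {R : realType}.
Implicit Types (w v : nat -> step -> R).

(* [hit w n d k] is the weight of the [n]-step paths from distance [d] which
   first reach distance 0 at step [n], with total displacement [k]; steps marked
   0 keep the position, [Toward1] decreases it and [Away1] increases it. *)
Fixpoint hit w (n d : nat) (k : int) : R :=
  match n, d with
  | 0, 0 => (k == 0)%:R
  | n'.+1, d'.+1 =>
      w d Toward0 * hit w n' d' k + w d Toward1 * hit w n' d' (k + 1) +
      w d Away0 * hit w n' d.+1 k + w d Away1 * hit w n' d.+1 (k - 1)
  | _, _ => 0
  end.

Definition step_sum w d := w d Toward0 + w d Toward1 + w d Away0 + w d Away1.

Lemma hit_ge0 w n d k : (forall d e, 0 <= w d e) -> 0 <= hit w n d k.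
Proof.
move=> w0; elim: n d k => [|n IH] [|d] k //=.
by rewrite !addr_ge0 ?mulr_ge0.
Qed.

Lemma hit_le w (t : R) n d k : (forall d e, 0 <= w d e) -> 0 <= t ->
  (forall d, step_sum w d <= t) -> hit w n d k <= t ^+ n.
Proof.
move=> w0 t0 wt; elim: n d k => [|n IH] [|d] k //=; rewrite ?exprn_ge0 //.
  by case: eqP; rewrite ?ler01.
rewrite exprS; apply: (@le_trans _ _ (step_sum w d.+1 * t ^+ n)).
  rewrite /step_sum !mulrDl; do !apply: lerD; exact: ler_wpM2l.
by apply: ler_wpM2r => //; apply: exprn_ge0.
Qed.

Lemma hit_scale w (t : R) n d k :
  hit (fun d e => t * w d e) n d k = t ^+ n * hit w n d k.
Proof.
elim: n d k => [|n IH] [|d] k /=; rewrite ?mul1r ?mulr0 // !IH exprS; ring.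
Qed.

Lemma hit_cvg (wm : nat -> nat -> step -> R) w n d k :
  (forall d e, (fun m => wm m d e) @ \oo --> w d e) ->
  (fun m => hit (wm m) n d k) @ \oo --> hit w n d k.
Proof.
move=> cw; elim: n d k => [|n IH] [|d] k /=; try exact: cvg_cst.
by do !apply: cvgD; apply: cvgM.
Qed.

Lemma hit_far w L n d k : (forall d e, (L < d)%N -> w d e = 0) -> (L < d)%N ->
  hit w n d k = 0.
Proof. by move=> w0; case: n d => [|n] [|d] h //=; rewrite !w0 // !mul0r !addr0. Qed.

Definition hit_total w d k : R := limn (series (fun n => hit w n d k)).

Lemma cvg_geo (t : R) : 0 <= t < 1 -> cvgn (series (fun n => t ^+ n)).
Proof.
move=> /andP[t0 t1]; have := @cvg_geometric_series R 1 t.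
rewrite ger0_norm // => /(_ t1) /cvgP.
have -> // : geometric 1 t = (fun n => t ^+ n).
by apply/funext => n /=; rewrite mul1r.
Qed.

Lemma hit_total_le w (t : R) d k : (forall d e, 0 <= w d e) -> 0 <= t < 1 ->
  (forall d, step_sum w d <= t) ->
  cvgn (series (fun n => hit w n d k)) /\ 0 <= hit_total w d k <= limn (series (fun n => t ^+ n)).
Proof.
move=> w0 ht wt; have t0 : 0 <= t by have /andP[] := ht.
have h n : 0 <= hit w n d k <= t ^+ n by rewrite hit_ge0 // hit_le.
have [c /(_ 0%N)] := dominated_series h (cvg_geo ht).
by rewrite ![series _ 0%N]/series /= !big_geq // !subr0.
Qed.

Lemma hit_total0 w k : hit_total w 0 k = unit_seq k.
Proof.
apply: cvg_lim => //; rewrite -(cvg_shiftS (series _)).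
have -> : [sequence series (fun n => hit w n 0 k) n.+1]_n = cst (unit_seq k).
  apply/funext => n; rewrite /series /= big_nat_recl // big1 ?addr0 //.
exact: cvg_cst.
Qed.

Lemma hit_total_rec w (t : R) d k : (forall d e, 0 <= w d e) -> 0 <= t < 1 ->
  (forall d, step_sum w d <= t) -> hit_total w d.+1 k =
  w d.+1 Toward0 * hit_total w d k + w d.+1 Toward1 * hit_total w d (k + 1) +
  w d.+1 Away0 * hit_total w d.+2 k + w d.+1 Away1 * hit_total w d.+2 (k - 1).
Proof.
move=> w0 ht wt; have c d' k' := (hit_total_le d' k' w0 ht wt).1.
apply: cvg_lim => //; rewrite -(cvg_shiftS (series _)).
have -> : [sequence series (fun n => hit w n d.+1 k) n.+1]_n = (fun N =>
   w d.+1 Toward0 * series (fun n => hit w n d k) N +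
   w d.+1 Toward1 * series (fun n => hit w n d (k + 1)) N +
   w d.+1 Away0 * series (fun n => hit w n d.+2 k) N +
   w d.+1 Away1 * series (fun n => hit w n d.+2 (k - 1)) N).
  apply/funext => N; rewrite /series /= big_nat_recl // add0r.
  by rewrite !big_split /= -!mulr_sumr.
by do !apply: cvgD; apply: cvgMr; apply: c.
Qed.

Lemma hit_total_decomposable w (t : R) m l : (forall d e, 0 < w d e) -> 0 <= t < 1 ->
  (forall d, step_sum w d <= t) ->
  decomposable (nseq l./2 Geo ++ nseq l./2 RGeo ++ nseq l.+1 TP)
    (hit_total (fun d e => if (d <= (m + l).+1)%N then w d e else 0) l.+1).
Proof.
move=> w0 ht wt; set L := (m + l).+1; set v := fun d e => _.
have v0 d e : 0 <= v d e by rewrite /v; case: ifP => // _; apply: ltW.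
have vt d : step_sum v d <= t.
  rewrite /step_sum /v; case: ifP => _; first exact: wt.
  by rewrite !addr0; have /andP[] := ht.
have t1 : t <= 1 by have /andP[_ /ltW] := ht.
pose h i := hit_total v (L - i).
have -> : hit_total v l.+1 = h m by rewrite /h; congr hit_total; rewrite /L; lia.
(* The chain numbers levels from the truncated end [L], [hit] by their distance from the target:
   hence the reversal [L - i]. *)
apply: (@chain_decomposable R (fun i => w (L - i)%N Toward0)
  (fun i => w (L - i)%N Toward1) (fun i => w (L - i)%N Away0)
  (fun i => w (L - i)%N Away1)) => //.
- by move=> i; apply: le_trans t1; apply: wt.
- move=> i; exists (limn (series (fun n => t ^+ n))) => k.
  by have [_ /andP[h1 h2]] := hit_total_le (L - i) k v0 ht vt; rewrite ger0_norm.
- by apply/funext => k; rewrite /h subnn hit_total0.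
move=> i k iL; rewrite /h.
have -> : (L - i)%N = (L - i.+1)%N.+1 by lia.
rewrite (hit_total_rec _ _ v0 ht vt) /v !ifT; try lia.
rewrite -addrA; congr (_ + _).
case: i iL => [|i] iL.
  have far k' : hit_total v (L - 1).+2 k' = 0.
    apply: cvg_lim => //.
    have -> : series (fun n => hit v n (L - 1).+2 k') = cst 0.
      apply/funext => n; rewrite /series /= big1 // => j _.
      by apply: (@hit_far _ L); rewrite /v => *; rewrite ?ifF //; lia.
    exact: cvg_cst.
  by rewrite !far !mulr0 addr0.
by have -> : (L - i.+2).+2 = (L - i)%N by lia.
Qed.

End Hitting.

(** * Removing the perturbation, the truncation and the damping *)

Section Perturbation.
Context {R : realType} (w : nat -> step -> R) (l : nat).
Hypothesis w_ge0 : forall d e, 0 <= w d e.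
Hypothesis w_le1 : forall d, step_sum w d <= 1.

(** Adding [harmonic m] to each of the four weights makes them positive; the denominator restores a
    total of at most [t]. *)
Definition perturb (t : R) (m d : nat) (e : step) : R :=
  t * ((w d e + harmonic m) / (1 + 4 * harmonic m)).

Lemma harmonic_pos m : 0 < harmonic m :> R.
Proof. by rewrite /harmonic /= invr_gt0. Qed.

Lemma perturb_gt0 t m d e : 0 < t -> 0 < perturb t m d e.
Proof.
move=> t0; have h := harmonic_pos m.
rewrite /perturb; apply: mulr_gt0 => //; apply: divr_gt0; first exact: ltr_wpDl.
by rewrite addr_gt0 // mulr_gt0.
Qed.

Lemma perturb_le t m d : 0 < t -> step_sum (perturb t m) d <= t.
Proof.
move=> t0; have h := harmonic_pos m; have := w_le1 d.
have den : 0 < 1 + 4 * harmonic m :> R by rewrite addr_gt0 // mulr_gt0.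
rewrite /step_sum /perturb -!mulrDr -!mulrDl => hw.
apply: ler_piMr; first exact: ltW.
by rewrite ler_pdivrMr // mul1r; move: hw; rewrite /step_sum; lra.
Qed.

(** A single limit removes both devices: the window of levels grows with [m] while the perturbation
    shrinks. *)
Lemma perturb_cvg t d e : (fun m => if (d <= (m + l).+1)%N then perturb t m d e else 0)
  @ \oo --> t * w d e.
Proof.
apply: (@cvg_trans _ (perturb t ^~ d ^~ e @ \oo)).
  by apply: near_eq_cvg; exists d => // m /= dm; rewrite ifT //; lia.
apply: cvgMr; rewrite -[X in _ --> X]divr1; apply: cvgM.
  rewrite -[X in _ --> X]addr0; apply: cvgD; first exact: cvg_cst.
  exact: cvg_harmonic.
apply: cvgV; first exact: oner_neq0.
rewrite -[X in _ --> X]addr0; apply: cvgD; first exact: cvg_cst.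
by rewrite -[X in _ --> X](mulr0 4); apply: cvgMr; apply: cvg_harmonic.
Qed.

(** Paths of length [n] weigh at most [t ^+ n], whatever [m]; this majorant allows the limit in [m]
    to be taken under the sum over [n]. *)
Lemma hit_decomposable_damped (t : R) : 0 < t < 1 ->
  let f := hit_total (fun d e => t * w d e) l.+1 in
  vanishing f -> (exists k, f k != 0) -> decomposable
    (nseq l./2 Geo ++ nseq l./2 RGeo ++ nseq l.+1 TP) f.
Proof.
move=> /andP[t0 t1] f vf nf.
have ht : 0 <= t < 1 by rewrite ltW.
pose v m d e := if (d <= (m + l).+1)%N then perturb t m d e else 0.
have v0 m d e : 0 <= v m d e by rewrite /v; case: ifP => // _; apply/ltW/perturb_gt0.
have vt m d : step_sum (v m) d <= t.
  rewrite /step_sum /v; case: ifP => _; first exact: perturb_le.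
  by rewrite !addr0 ltW.
apply: (@decomposable_cvgn R _ (limn (series (fun n => t ^+ n)))
  (fun m => hit_total (v m) l.+1)) => //.
- by move=> m k; apply: (hit_total_le l.+1 k (v0 m) ht (vt m)).2.
- move=> m; apply: (@hit_total_decomposable R (perturb t m) t m l) => //.
    by move=> d e; apply: perturb_gt0.
  by move=> d; apply: perturb_le.
- move=> k; apply: (@tannery R (fun m n => hit (v m) n l.+1 k) (fun n => t ^+ n)).
  + by move=> m n; rewrite hit_ge0 //= hit_le // ltW.
  + exact: cvg_geo.
  + by move=> n; apply: hit_cvg => d e; apply: perturb_cvg.
Qed.

(** For the limit [t -> 1] the convergent undamped series is the majorant. *)
Lemma hit_decomposable f (C : R) :
  (forall k, series (fun n => hit w n l.+1 k) @ \oo --> f k) ->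
  (forall k, f k <= C) -> vanishing f -> (exists k, f k != 0) ->
  decomposable
    (nseq l./2 Geo ++ nseq l./2 RGeo ++ nseq l.+1 TP) f.
Proof.
move=> cf fC vf [k0 fk0].
have cfk k : cvgn (series (fun n => hit w n l.+1 k)) by apply: cvgP (cf k).
have fE k : limn (series (fun n => hit w n l.+1 k)) = f k by apply: cvg_lim (cf k).
pose t m : R := 1 - (m.+2%:R)^-1.
have t01 m : 0 < t m < 1.
  by rewrite /t subr_gt0 invf_lt1 // ltr1n /= gtrBl invr_gt0.
have tE m n k : hit (fun d e => t m * w d e) n l.+1 k = t m ^+ n * hit w n l.+1 k.
  exact: hit_scale.
have h0 n k : 0 <= hit w n l.+1 k by apply: hit_ge0.
have dom m n k : 0 <= hit (fun d e => t m * w d e) n l.+1 k <= hit w n l.+1 k.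
  have /andP[a b] := t01 m.
  rewrite tE mulr_ge0 ?exprn_ge0 ?(ltW a) //= ler_piMl //.
  by apply: exprn_ile1; apply: ltW.
have ft m k : 0 <= hit_total (fun d e => t m * w d e) l.+1 k <= f k.
  have [c /(_ 0%N)] := dominated_series (fun n => dom m n k) (cfk k).
  by rewrite ![series _ 0%N]/series /= !big_geq // !subr0 fE.
(* A single path length of nonzero weight keeps every damped total nonzero at [k0]. *)
have [n0 hn0] : exists n0, hit w n0 l.+1 k0 != 0.
  apply: contrapT => /forallNP hz; case/eqP: fk0; rewrite -fE; apply: cvg_lim => //.
  rewrite (_ : series _ = cst 0); first exact: cvg_cst.
  apply/funext => n; rewrite /series /= big1 // => i _.
  by apply/eqP/negPn/negP; apply: hz.
apply: (@decomposable_cvgn R _ C (fun m => hit_total (fun d e => t m * w d e) l.+1)).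
- by move=> m k; have /andP[-> h] := ft m k; apply: le_trans h (fC k).
- move=> m; apply: hit_decomposable_damped => //.
    apply: vanishing_le vf => k; have /andP[h1 h2] := ft m k.
    by rewrite ger0_norm.
  exists k0; rewrite gt_eqF //.
  have [c /(_ n0.+1) /andP[h _]] := dominated_series (fun n => dom m n k0) (cfk k0).
  have /andP[a b] := t01 m.
  apply: (lt_le_trans _ (_ : series (fun n => hit (fun d e => t m * w d e) n l.+1 k0) n0.+1 <= _)); last by rewrite -subr_ge0.
  rewrite /series /= big_nat_recr //=; apply: ltr_wpDl.
    by apply: sumr_ge0 => i _; have /andP[] := dom m i k0.
  by rewrite tE mulr_gt0 ?exprn_gt0 // lt_def hn0 h0.
- move=> k; rewrite -fE; apply: (@tannery R (fun m n => hit (fun d e => t m * w d e) n l.+1 k)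
    (fun n => hit w n l.+1 k)) => // n.
  rewrite (_ : (fun m => _) = (fun m => t m ^+ n * hit w n l.+1 k)); last first.
    by apply/funext => m; rewrite tE.
  rewrite -[X in _ --> X]mul1r; apply: cvgMl.
  rewrite -[X in _ --> X](expr1n _ n).
  have ct : t @ \oo --> (1 : R).
    rewrite /t -[X in _ --> X]subr0; apply: cvgB; first exact: cvg_cst.
    have := @cvg_harmonic R; rewrite -(cvg_shiftS (@harmonic R)) => h.
    by apply: cvg_trans h.
  elim: (n) => [|i IH].
    by rewrite expr0 (_ : (fun m => _) = cst 1) //; exact: cvg_cst.
  rewrite exprS (_ : (fun m => _) = (fun m => t m * t m ^+ i)).
    exact: cvgM.
  by apply/funext => m; rewrite exprS.
- exact: vf.
- by exists k0.
Qed.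

End Perturbation.

(** * The honeycomb walk *)

Section SummableVanishing.
Context {R : realType}.
Implicit Types (f : int -> R).

Lemma esum_nat_cvg0 (u : nat -> R) : (forall n, 0 <= u n) ->
  (\esum_(n in [set: nat]) (u n)%:E < +oo)%E -> u @ \oo --> (0 : R).
Proof.
move=> u0; rewrite -nneseries_esumT => [fin|n]; last by rewrite lee_fin.
apply: cvg_series_cvg_0; apply: nondecreasing_is_cvgn.
  apply/nondecreasing_seqP => n.
  by rewrite /series /= big_nat_recr //= lerDl.
exists (fine (\sum_(n <oo) (u n)%:E)) => _ [n _ <-].
rewrite -lee_fin fineK; last first.
  by rewrite ge0_fin_numE //; apply: nneseries_ge0 => k _ _; rewrite lee_fin.
rewrite /series /= -sumEFin.
by apply: nneseries_lim_ge => k _ *; rewrite lee_fin.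
Qed.

Lemma nonneg_summable_vanishing f : nonneg_summable f -> vanishing f.
Proof.
move=> [f0 sf].
have sub (g : nat -> int) : injective g ->
    (fun n => f (g n)) @ \oo --> (0 : R).
  move=> gi; apply: esum_nat_cvg0 => //; apply: le_lt_trans sf.
  rewrite -(esum_image setT g (fun j => (f j)%:E)); last by move=> x y _ _ /gi.
  rewrite esum_mkcond; apply: le_esum => j _; case: ifP => // _.
  by rewrite lee_fin.
move=> e e0.
have /cvgrPdist_lt/(_ _ e0)[K1 _ h1] := sub Posz ltac:(by move=> x y []).
have /cvgrPdist_lt/(_ _ e0)[K2 _ h2] := sub (fun n => - n%:Z) ltac:(by move=> x y; lia).
exists (K1 + K2)%N => -[k|k] hk.
  by rewrite -normrN -[- _]sub0r; apply: h1; rewrite /=; lia.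
by rewrite -normrN -[- _]sub0r NegzE; apply: h2; rewrite /=; lia.
Qed.

End SummableVanishing.

(** * Measurability and null sets *)

Section ProbabilityFacts.
Context {R : realType} {d : measure_display} {T : measurableType d}
  (P : probability T R).

Lemma measurable_countable_fiber (C : countType) (g : T -> C) (phi : C -> Prop) :
  (forall z, measurable [set t | g t = z]) -> measurable [set t | phi (g t)].
Proof.
move=> mg.
have -> : [set t | phi (g t)] =
    \bigcup_z (if `[< phi z >] then [set t | g t = z] else set0).
  apply/seteqP; split=> [t /= h|t [z _]].
    by exists (g t) => //; rewrite asboolT.
  by case: asboolP => // h /= ->.
apply: countable_bigcupT_measurable => // z; by case: ifP.
Qed.

Lemma probability_setI1 (A B : set T) : measurable A -> measurable B ->
  P B = 1%E -> P (A `&` B) = P A.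
Proof.
move=> mA mB PB.
have PC : P (~` B) = 0%E by rewrite probability_setC // PB subee.
rewrite -[in RHS](setUIDK A B) measureU0 //.
- exact: measurableI.
- exact: measurableD.
- apply: (subset_measure0 _ _ _ PC); [exact: measurableD|exact: measurableC|].
  by move=> t [].
Qed.

(** The Markov property provides only the masses of the three continuations of a history. As these
    add up to the mass of the history, the continuations exhaust it up to a null set. *)
Lemma probability_split3 (A A1 A2 A3 E : set T) : measurable A -> measurable A1 ->
  measurable A2 -> measurable A3 -> measurable E ->
  A1 `<=` A -> A2 `<=` A -> A3 `<=` A ->
  A1 `&` A2 = set0 -> A1 `&` A3 = set0 -> A2 `&` A3 = set0 ->
  P A = (P A1 + P A2 + P A3)%E ->
  P (A `&` E) = (P (A1 `&` E) + P (A2 `&` E) + P (A3 `&` E))%E.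
Proof.
move=> mA m1 m2 m3 mE s1 s2 s3 d12 d13 d23 PA.
pose B := A1 `|` A2 `|` A3.
have mB : measurable B by do !apply: measurableU.
have add (F : set T) : measurable F ->
    P (B `&` F) = (P (A1 `&` F) + P (A2 `&` F) + P (A3 `&` F))%E.
  move=> mF; rewrite /B !setIUl !measureU //; try exact: measurableI;
    try (apply: measurableU; exact: measurableI).
  - by apply/seteqP; split=> // t [[h1 _] [h2 _]]; rewrite -d12.
  - apply/seteqP; split=> // t [[[h1 _]|[h1 _]] [h2 _]].
      by rewrite -d13.
    by rewrite -d23.
have sB : B `<=` A by move=> t [[/s1|/s2]|/s3].
have PB : P B = P A.
  by have := add setT measurableT; rewrite !setIT PA.
have PD : P (A `\` B) = 0%E.
  have e : P A = (P B + P (A `\` B))%E.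
    rewrite -measureU ?setDUK //; first exact: measurableD.
    by rewrite setDE setICA setICr setI0.
  have fA : P A \is a fin_num by apply: fin_num_measure.
  have fD : P (A `\` B) \is a fin_num by apply/fin_num_measure/measurableD.
  have h : fine (P A) = fine (P A) + fine (P (A `\` B)).
    by rewrite -fineD // -[in RHS]PB -e.
  have h0 : fine (P (A `\` B)) = 0 by lra.
  by rewrite -(fineK fD) h0.
rewrite -add // -[A in LHS](setDUK sB) setIUl measureU0 //.
- exact: measurableI.
- by apply: measurableI => //; apply: measurableD.
- apply: (subset_measure0 _ _ _ PD); [|exact: measurableD|by move=> t []].
  by apply: measurableI => //; apply: measurableD.
Qed.

End ProbabilityFacts.

Lemma halfz_even (j : int) : (2 %| j)%Z ->
  [/\ j = (j %/ 2)%Z * 2, ((j + 1) %/ 2)%Z = (j %/ 2)%Z &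
      ((j - 1) %/ 2)%Z = (j %/ 2)%Z - 1].
Proof. by move=> h; split; lia. Qed.

Lemma halfz_odd (j : int) : (2 %| j)%Z = false ->
  [/\ j = (j %/ 2)%Z * 2 + 1, ((j + 1) %/ 2)%Z = (j %/ 2)%Z + 1 &
      ((j - 1) %/ 2)%Z = (j %/ 2)%Z].
Proof. by move=> h; split; lia. Qed.

(** * From jumps on the lattice to steps towards and away from [a] *)

Section WalkSteps.
Context {R : realType} (q : int -> jump -> R) (up : bool) (a : int).

Definition level_at (d : nat) : int := if up then a - d%:Z else a + d%:Z.

(** Every jump changes both [xhat] and the level by one. So [xhat] plus the distance to [a] changes
    by 0 or -2 on a step towards [a], and by 0 or 2 on a step away; halved, this is the displacement
    of [hit]. *)
Definition walk_steps (d : nat) (e : step) : R :=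
  let j := level_at d in let even := (2 %| j)%Z in
  match e with
  | Toward0 => if even then q j (if up then jump_right else jump_vertical)
               else if up then 0 else q j jump_right
  | Toward1 => if even then (if up then q j jump_left else 0)
               else q j (if up then jump_vertical else jump_left)
  | Away0 => if even then (if up then 0 else q j jump_left)
             else q j (if up then jump_left else jump_vertical)
  | Away1 => if even then q j (if up then jump_vertical else jump_right)
             else if up then q j jump_right else 0
  end.

Hypothesis q_law : jump_law q.

Lemma walk_steps_ge0 d e : 0 <= walk_steps d e.
Proof.
have [q0 _] := q_law; rewrite /walk_steps.
by case: e; case: ifP => _; case: up.
Qed.

Lemma walk_steps_sum d : step_sum walk_steps d = 1.
Proof.
have [_ /(_ (level_at d)) <-] := q_law; rewrite /step_sum /walk_steps.
by case: ifP => _; case: up; ring.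
Qed.

Lemma walk_steps_toward d : (forall j, 0 < prob_up q j) ->
  (forall j, 0 < prob_down q j) ->
  0 < walk_steps d Toward0 + walk_steps d Toward1.
Proof.
move=> /(_ (level_at d)) + /(_ (level_at d)).
rewrite /prob_up /prob_down /walk_steps.
by case: ifP => _; case: up; rewrite ?addr0 ?add0r.
Qed.

(** For a jump from distance [d + 1], not [d], with displacement [k] still to be made: the new
    distance and the displacement then left. *)
Definition jump_distance (even : bool) (d : nat) (k : int) (e : jump) : nat * int :=
  match e with
  | jump_right => if even == up then (d, k) else (d.+2, k - 1)
  | jump_left => if even == up then (d, k + 1) else (d.+2, k)
  | jump_vertical =>
      if even then (if up then (d.+2, k - 1) else (d, k))
      else (if up then (d, k + 1) else (d.+2, k))
  end.

Lemma jump_distanceP (z : int * int) d (k v : int) (e : jump) :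
  z.2 = level_at d.+1 -> v = xhat z + d.+1%:Z + 2 * k ->
  let p := jump_distance (2 %| z.2)%Z d k e in
  (jump_target e z).2 = level_at p.1 /\
  v = xhat (jump_target e z) + p.1%:Z + 2 * p.2.
Proof.
case: z => i j /=; rewrite /xhat /level_at /jump_target /jump_distance /= => ej ->.
case hj : (2 %| j)%Z; [have [_ jS jP] := halfz_even hj|have [_ jS jP] := halfz_odd hj];
  case: e; case: up ej => ej /=;
  rewrite ?opprK ?jS ?jP; move: (j %/ 2)%Z => c; clear -ej; split; lia.
Qed.

Lemma hit_jump n d k :
  hit walk_steps n.+1 d.+1 k =
  let p e := jump_distance (2 %| level_at d.+1)%Z d k e in
  q (level_at d.+1) jump_right * hit walk_steps n (p jump_right).1 (p jump_right).2 +
  q (level_at d.+1) jump_left * hit walk_steps n (p jump_left).1 (p jump_left).2 +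
  q (level_at d.+1) jump_vertical * hit walk_steps n (p jump_vertical).1 (p jump_vertical).2.
Proof.
rewrite /=; move: (hit walk_steps n) => h; rewrite /walk_steps /jump_distance.
by case: ifP => _; case: up => /=; ring.
Qed.

End WalkSteps.

(** * The Markov property along paths *)

Section Walk.
Context {R : realType} {d : measure_display} {T : measurableType d}
  (P : probability T R) (q : int -> jump -> R) (Z : nat -> T -> int * int)
  (z0 : int * int) (up : bool) (a : int).
Hypothesis q_law : jump_law q.
Hypothesis walkP : honeycomb_walk P q z0 Z.

Definition passage_event (n : nat) (v : int) : set T :=
  [set t | first_passage_at Z a n t /\ xhat (Z n t) = v].

Lemma measurable_state n (phi : int * int -> Prop) :
  measurable [set t | phi (Z n t)].
Proof.
by apply: measurable_countable_fiber => z; have [_ mZ _ _] := walkP; apply: mZ.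
Qed.

Lemma measurable_history w n : measurable (history Z w n).
Proof.
elim: n => [|n IH].
  have -> : history Z w 0 = [set t | Z 0%N t = w 0%N].
    apply/seteqP; split=> t /= h; first exact: h.
    by move=> m; rewrite leqn0 => /eqP ->.
  exact: (@measurable_state 0 (fun z => z = w 0%N)).
have -> : history Z w n.+1 = history Z w n `&` [set t | Z n.+1 t = w n.+1].
  apply/seteqP; split=> [t h|t [h1 h2] m].
    by split=> [m mn|]; apply: h => //; apply: leqW.
  by rewrite leq_eqVlt => /orP[/eqP -> //|]; apply: h1.
by apply: measurableI => //; apply: (@measurable_state n.+1 (fun z => z = w n.+1)).
Qed.

Lemma measurable_first_passage n : measurable (first_passage_at Z a n).
Proof.
have m1 : measurable [set t | forall m : nat, (m < n)%N -> (Z m t).2 <> a].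
  elim: (n) => [|i IH].
    by rewrite [X in measurable X](_ : _ = setT) //; apply/seteqP; split.
  have -> : [set t | forall m : nat, (m < i.+1)%N -> (Z m t).2 <> a] =
      [set t | forall m : nat, (m < i)%N -> (Z m t).2 <> a] `&`
      [set t | (Z i t).2 <> a].
    apply/seteqP; split=> [t h|t [h1 h2] m].
      by split=> [m mi|]; apply: h => //; apply: ltnW.
    by rewrite ltnS leq_eqVlt => /orP[/eqP -> //|]; apply: h1.
  by apply: measurableI => //; apply: (@measurable_state i (fun z => z.2 <> a)).
exact: (measurableI _ _ (@measurable_state n (fun z => z.2 = a)) m1).
Qed.

Lemma measurable_passage_event n v : measurable (passage_event n v).
Proof.
apply: measurableI (measurable_first_passage n) _.
exact: (@measurable_state n (fun z => xhat z = v)).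
Qed.

(** Induction on the number of steps left, over all histories that have avoided [a]. The location
    [v] at the passage is fixed, and [k] is the displacement still needed to end there. *)
Lemma first_passage_hit n m (w : nat -> int * int) dd (k v : int) :
  (forall i, (i < m)%N -> (w i).2 <> a) -> (w m).2 = level_at up a dd ->
  v = xhat (w m) + dd%:Z + 2 * k ->
  P (history Z w m `&` passage_event (m + n) v) =
  ((hit (walk_steps q up a) n dd k)%:E * P (history Z w m))%E.
Proof.
elim: n m w dd k => [|n IH] m w [|dd] k wa wm hv.
- rewrite addn0 /=; have wma : (w m).2 = a by rewrite wm /level_at; case: up; lia.
  have [k0|k0] := eqVneq k 0.
    rewrite mul1e; congr (P _); apply/seteqP; split=> [t []//|t ht]; split=> //.
    split; first by split=> [|i im]; rewrite ht ?(ltnW im) //; apply: wa.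
    by rewrite ht // hv k0; lia.
  rewrite mul0e; rewrite [X in P X](_ : _ = set0) ?measure0 //.
  apply/seteqP; split=> // t [ht [_ e]]; rewrite (ht m (leqnn _)) hv in e.
  by case/eqP: k0; lia.
- rewrite addn0 /= mul0e [X in P X](_ : _ = set0) ?measure0 //.
  apply/seteqP; split=> // t [ht [[e _] _]]; move: e.
  by rewrite (ht m (leqnn _)) wm /level_at; case: up; lia.
- rewrite mul0e [X in P X](_ : _ = set0) ?measure0 //.
  apply/seteqP; split=> // t [ht [[_ /(_ m) no] _]]; case: no; first lia.
  by rewrite (ht m (leqnn _)) wm /level_at; case: up; lia.
(* The history prolonged by the jump [e]. *)
pose we e i := if (i <= m)%N then w i else jump_target e (w m).
have weE e : we e m.+1 = jump_target e (w m) by rewrite /we ltnn.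
have Ae e : history Z (we e) m.+1 =
    history Z w m `&` [set t | Z m.+1 t = jump_target e (w m)].
  apply/seteqP; split=> [t h|t [h1 h2] i].
    split=> [i im|]; last by rewrite -weE; apply: h.
    by have := h i (leqW im); rewrite /we im.
  by rewrite leq_eqVlt ltnS => /orP[/eqP ->|im]; rewrite ?weE // /we im; apply: h1.
have [_ _ _ markov] := walkP.
have [q0 q1] := q_law.
have PAe e : P (history Z (we e) m.+1) = ((q (w m).2 e)%:E * P (history Z w m))%E.
  by rewrite Ae markov.
have step e : P (history Z (we e) m.+1 `&` passage_event (m + n.+1) v) =
    (let p := jump_distance up (2 %| (w m).2)%Z dd k e in
    (hit (walk_steps q up a) n p.1 p.2)%:E *
    ((q (w m).2 e)%:E * P (history Z w m)))%E.
  have [h1 h2] := jump_distanceP e wm hv.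
  rewrite -PAe addnS -addSn; apply: IH.
  - move=> i im; rewrite /we -ltnS im.
    move: im; rewrite ltnS leq_eqVlt => /orP[/eqP ->|/wa //].
    by rewrite wm /level_at; case: up; lia.
  - by rewrite weE h1.
  - by rewrite weE.
have fA : P (history Z w m) \is a fin_num by apply/fin_num_measure/measurable_history.
have disj e e' : jump_target e (w m) <> jump_target e' (w m) ->
    history Z (we e) m.+1 `&` history Z (we e') m.+1 = set0.
  move=> ee'; apply/seteqP; split=> // t []; rewrite !Ae => -[_ h1] [_ h2].
  by apply: ee'; rewrite -h1 -h2.
have sub e : history Z (we e) m.+1 `<=` history Z w m by rewrite Ae => t [].
have dist1 : jump_target jump_right (w m) <> jump_target jump_left (w m).
  by rewrite /jump_target => -[]; lia.
have dist2 : jump_target jump_right (w m) <> jump_target jump_vertical (w m).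
  by rewrite /jump_target => -[]; lia.
have dist3 : jump_target jump_left (w m) <> jump_target jump_vertical (w m).
  by rewrite /jump_target => -[]; lia.
rewrite (@probability_split3 _ _ _ P _ (history Z (we jump_right) m.+1)
  (history Z (we jump_left) m.+1) (history Z (we jump_vertical) m.+1)) //;
  try exact: measurable_history; try exact: measurable_passage_event;
  try exact: disj.
- rewrite !step wm hit_jump -(fineK fA) -!EFinM -!EFinD; congr EFin.
  cbv zeta; move: (jump_distance _ _ _ _) => f; ring.
- rewrite !PAe -(fineK fA) -!EFinM -!EFinD; congr EFin.
  by rewrite -!mulrDl q1 mul1r.
Qed.

End Walk.

(** The straight path to the target, with a toward step of positive weight picked at each level. *)
Lemma hit_straight {R : realType} (w : nat -> step -> R) N :
  (forall i e, 0 <= w i e) -> (forall i, 0 < w i Toward0 + w i Toward1) ->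
  exists k, 0 < hit w N N k.
Proof.
move=> w0 w1; elim: N => [|n [k hk]]; first by exists 0; rewrite /= ltr01.
have h0 i j : 0 <= hit w n i j by apply: hit_ge0.
have [p0|p0] := ltP 0 (w n.+1 Toward0); last first.
  exists (k - 1); rewrite /= subrK -!addrA; apply: ltr_wpDl; first exact: mulr_ge0.
  apply: ltr_wpDr; first by apply: addr_ge0; apply: mulr_ge0.
  by apply: mulr_gt0 => //; have := w1 n.+1; lra.
exists k; rewrite /= -!addrA; apply: ltr_wpDr; last exact: mulr_gt0.
by do !apply: addr_ge0; apply: mulr_ge0.
Qed.

(** * The law of the first passage location *)

Section PassagePmf.
Context {R : realType} {d : measure_display} {T : measurableType d}
  (P : probability T R) (q : int -> jump -> R) (Z : nat -> T -> int * int)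
  (z0 : int * int) (up : bool) (a : int) (N : nat).
Hypothesis q_law : jump_law q.
Hypothesis walkP : honeycomb_walk P q z0 Z.
Hypothesis start_level : z0.2 = level_at up a N.

Definition passage_set (k : int) : set T := [set t | exists n : nat,
  first_passage_at Z a n t /\
  xhat (Z n t) - xhat (Z 0%N t) - `|z0.2 - a| = 2 * k].

Let start_set : set T := [set t | Z 0%N t = z0].

Lemma measurable_start : measurable start_set.
Proof. exact: (measurable_state walkP 0 (fun z => z = z0)). Qed.

Lemma measurable_passage (phi : int * int -> int * int -> Prop) :
  measurable [set t | exists n : nat, first_passage_at Z a n t /\ phi (Z n t) (Z 0%N t)].
Proof.
have -> : [set t | exists n : nat, first_passage_at Z a n t /\ phi (Z n t) (Z 0%N t)] =
    \bigcup_n (first_passage_at Z a n `&` [set t | phi (Z n t) (Z 0%N t)]).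
  apply/seteqP; split=> [t [n [h1 h2]]|t [n _ [h1 h2]]]; first by exists n.
  by exists n.
apply: bigcupT_measurable => n; apply: measurableI.
  exact: measurable_first_passage walkP n.
apply: (@measurable_countable_fiber _ _ (int * int * (int * int))%type
  (fun t => (Z n t, Z 0%N t)) (fun p => phi p.1 p.2)) => -[u v].
have -> : [set t | (Z n t, Z 0%N t) = (u, v)] = [set t | Z n t = u] `&` [set t | Z 0%N t = v].
  by apply/seteqP; split=> t /= [-> ->].
apply: measurableI; first exact: (measurable_state walkP n (fun z => z = u)).
exact: (measurable_state walkP 0 (fun z => z = v)).
Qed.

Lemma measurable_passage_set k : measurable (passage_set k).
Proof.
exact: (measurable_passage
  (fun z z' => xhat z - xhat z' - `|z0.2 - a| = 2 * k)).
Qed.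

Lemma first_passage_unique n n' t : first_passage_at Z a n t ->
  first_passage_at Z a n' t -> n = n'.
Proof.
move=> [h1 h2] [h1' h2']; have [nn|nn|//] := ltngtP n n'.
- by case: (h2' n nn).
- by case: (h2 n' nn).
Qed.

Lemma level_dist : `|z0.2 - a| = N%:Z.
Proof. by rewrite start_level /level_at; case: up; lia. Qed.

(** The event is split by the time of passage. The walk starts at [z0] only almost surely, hence the
    intersection with [start_set]. *)
Lemma passage_set_cvg k : series (fun n => hit (walk_steps q up a) n N k) @ \oo -->
  fine (P (passage_set k)).
Proof.
pose w0 (i : nat) := z0.
pose v := xhat z0 + N%:Z + 2 * k.
pose F n := history Z w0 0 `&` passage_event Z a n v.
have [_ _ P1 _] := walkP.
have hist0 : history Z w0 0 = start_set.
  apply/seteqP; split=> t h; first exact: h.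
  by move=> m; rewrite leqn0 => /eqP ->.
have PF n : P (F n) = (hit (walk_steps q up a) n N k)%:E.
  have := @first_passage_hit R d T P q Z z0 up a q_law walkP n 0 w0 N k v.
  by rewrite add0n hist0 P1 mule1; rewrite /F hist0; apply.
have SF : passage_set k `&` start_set = \bigcup_n F n.
  apply/seteqP; split=> [t [[n [h1 h2]] h0]|t [n _ [h0 [h1 h2]]]].
    exists n => //; rewrite /F hist0; split=> //; split=> //.
    by rewrite h0 level_dist in h2; rewrite /v; lia.
  rewrite hist0 in h0; split=> //; exists n; split=> //.
  by rewrite h0 level_dist h2 /v; lia.
have mF n : measurable (F n).
  apply: measurableI; first exact: measurable_history walkP _ _.
  exact: measurable_passage_event walkP _ _.
have PS : P (passage_set k) = P (\bigcup_n F n).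
  rewrite -SF probability_setI1 //; first exact: measurable_passage_set.
  exact: measurable_start.
have tF : trivIset setT F.
  move=> i j _ _ [t [[_ [hi _]] [_ [hj _]]]].
  exact: first_passage_unique hi hj.
have : (fun n => \sum_(0 <= i < n) P (F i))%E @ \oo --> P (passage_set k).
  by rewrite PS; apply: measure_semi_sigma_additive => //; apply: bigcupT_measurable.
rewrite -[P (passage_set k)]fineK; last first.
  exact/fin_num_measure/measurable_passage_set.
move=> /fine_cvgP[_]; apply: cvg_trans; apply: near_eq_cvg; apply: nearW => n /=.
by rewrite /series /= (eq_bigr _ (fun i _ => PF i)) sumEFin.
Qed.

Lemma nonneg_summable_passage : nonneg_summable (fun k => fine (P (passage_set k))).
Proof.
split=> [k|]; first exact: fine_ge0.
apply: (@le_lt_trans _ _ 1%E); last exact: ltry.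
apply: ge_ereal_sup => _ [X [finX _] <-].
have -> : (\sum_(k \in X) (fine (P (passage_set k)))%:E =
    \sum_(k \in X) P (passage_set k))%E.
  apply: eq_fsbigr => k _; rewrite fineK //.
  exact/fin_num_measure/measurable_passage_set.
rewrite -measure_fin_bigcup //.
- apply: probability_le1; apply: fin_bigcup_measurable => // k _.
  exact: measurable_passage_set.
- move=> i j _ _ [t [[n [h1 h2]] [n' [h1' h2']]]].
  by rewrite -(first_passage_unique h1 h1') h2 in h2'; lia.
- by move=> k _; apply: measurable_passage_set.
Qed.

Lemma passage_positive : (forall j, 0 < prob_up q j) -> (forall j, 0 < prob_down q j) ->
  exists k, fine (P (passage_set k)) != 0.
Proof.
move=> hu hd.
have w0 := walk_steps_ge0 up a q_law.
have [k hk] := hit_straight N w0 (fun i => walk_steps_toward up a i hu hd).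
exists k; rewrite gt_eqF //; apply: lt_le_trans hk _.
have c := @passage_set_cvg k.
rewrite -(cvg_lim _ c) //.
apply: (@le_trans _ _ (series (fun n => hit (walk_steps q up a) n N k) N.+1)).
  rewrite /series /= big_nat_recr //= lerDr; apply: sumr_ge0 => i _.
  exact: hit_ge0.
apply: nondecreasing_cvgn_le; last exact: cvgP c.
apply/nondecreasing_seqP => n.
by rewrite /series /= big_nat_recr //= lerDl hit_ge0.
Qed.

Lemma passage_decomposable l : N = l.+1 ->
  (forall j, 0 < prob_up q j) -> (forall j, 0 < prob_down q j) ->
  decomposable (nseq l./2 Geo ++ nseq l./2 RGeo ++ nseq l.+1 TP)
    (fun k => fine (P (passage_set k))).
Proof.
move=> Nl hu hd.
have sf := nonneg_summable_passage.
apply: (@hit_decomposable R (walk_steps q up a) l _ _ _ 1).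
- exact: walk_steps_ge0.
- by move=> j; rewrite walk_steps_sum.
- by move=> k; rewrite -Nl; apply: passage_set_cvg.
- move=> k; rewrite -lee_fin fineK; last first.
    exact/fin_num_measure/measurable_passage_set.
  exact/probability_le1/measurable_passage_set.
- exact: nonneg_summable_vanishing.
- exact: passage_positive.
Qed.

Lemma passage_set_start k :
  P (passage_set k) = P [set t | exists n : nat, first_passage_at Z a n t /\
    (Z n t).1 - z0.1 + (z0.2 %/ 2)%Z - (a %/ 2)%Z - `|z0.2 - a| = 2 * k].
Proof.
have [_ _ P1 _] := walkP.
have m1 := measurable_passage_set k.
have m2 := measurable_passage
  (fun z _ => z.1 - z0.1 + (z0.2 %/ 2)%Z - (a %/ 2)%Z - `|z0.2 - a| = 2 * k).
rewrite -(probability_setI1 m1 measurable_start P1).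
rewrite -(probability_setI1 m2 measurable_start P1).
congr (P _); apply/seteqP; split=> t [[n [[h1 h1'] h2]] h0]; split=> //;
  exists n; (split; first by []); move: h2; rewrite h0 /xhat h1; lia.
Qed.

End PassagePmf.

Theorem corollary1p3 (R : realType) (d : measure_display)
    (T : measurableType d) (P : probability T R)
    (q : int -> jump -> R) (Z : nat -> T -> int * int) (x y a : int)
    (hxy : honeycomb (x, y))
    (hq : jump_law q)
    (hup : forall j : int, 0 < prob_up q j)
    (hdown : forall j : int, 0 < prob_down q j)
    (hZ : honeycomb_walk P q (x, y) Z)
    (hay : a != y) :
  let f := first_passage_pmf P Z y a in
  [/\ forall k : int,
        f k = fine (P [set t | exists n : nat, first_passage_at Z a n t /\
          (Z n t).1 - x + (y %/ 2)%Z - (a %/ 2)%Z - `|y - a| = 2 * k]),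
      bell_shaped f &
      exists (gs hs ts : seq R) (c : int -> R),
        [/\ (size gs <= (`|y - a|%N - 1) %/ 2)%N /\
              (forall p, p \in gs -> 0 < p < 1),
            (size hs <= (`|y - a|%N - 1) %/ 2)%N /\
              (forall p, p \in hs -> 0 < p < 1),
            (size ts <= `|y - a|)%N /\
              (forall p, p \in ts -> 0 <= p <= 1),
            AM_CM c &
            f = convolution
                  (\big[convolution/unit_seq]_(p <- gs) geometric_seq p)
                  (convolution
                    (\big[convolution/unit_seq]_(p <- hs)
                       reflection (geometric_seq p))
                    (convolution
                      (\big[convolution/unit_seq]_(p <- ts)
                         reflection (two_point_seq p)) c))]].
Proof.
move=> f.
pose l := (`|y - a|%N - 1)%N.
have Nl : `|y - a|%N = l.+1 by rewrite /l; lia.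
have lev : (x, y).2 = level_at (y < a) a l.+1 by rewrite -Nl /level_at /=; case: ifP; lia.
have sf : nonneg_summable f := nonneg_summable_passage hZ lev.
have df := passage_decomposable hq hZ lev erefl hup hdown.
have nf : nonneg_nonzero f.
  split; first by case: sf.
  exact: passage_positive hq hZ lev hup hdown.
split; first by move=> k; apply: congr1 (passage_set_start hZ lev k).
  exact: decomposable_bell_shaped nf (nonneg_summable_vanishing sf) df.
have [gs [b1 [[sg hg] s1 d1 e1]]] := decomposable_nseq df sf.
have [hs [b2 [[sh hh] s2 d2 e2]]] := decomposable_nseq d1 s1.
rewrite -[nseq l.+1 TP]cats0 in d2.
have [ts [c [[st ht] s3 d3 e3]]] := decomposable_nseq d2 s2.
exists gs, hs, ts, c; rewrite divn2 -/l Nl; split=> //.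
- by split=> // p /hg[_]; apply.
- by split=> // p /hh[_]; apply.
- by split=> // p /ht[].
- by rewrite [LHS]e1 e2 e3.
Qed.
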